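(* Let $M\ge1$ be an integer. For the moment system $\vec B_M^0\,\partial_t\vec W_M+\vec B_M^1\,\partial_x\vec W_M=\vec S(\vec W_M)$ the $\lambda_{0,M}$-characteristic field is linearly degenerate, i.e. $$\nabla_{\vec W_M}\lambda_{0,M}(\vec W_M)\cdot\vec r_{0,M}(\vec W_M)=0\qquad\text{for all }\vec W_M\in\mathcal G_M .$$
   Context: Units: speed of light and particle rest mass equal to $1$. **Orthogonal polynomials.** For $\zeta>0$ let $K_n(\zeta)=\int_0^\infty\cosh(n\vartheta)e^{-\zeta\cosh\vartheta}d\vartheta$. For $\ell\in\{0,1\}$ let $\omega^{(\ell)}(x;\zeta)=K_1(\zeta)^{-1}(x^2-1)^{\ell-1/2}e^{-\zeta x}$ on $[1,\infty)$ and $(f,g)_{\omega^{(\ell)}}=\int_1^\infty fg\,\omega^{(\ell)}dx$. $\{P_n^{(\ell)}(x;\zeta)\}_{n\ge0}$ are the orthonormal polynomials for $(\cdot,\cdot)_{\omega^{(\ell)}}$ ($\deg P^{(\ell)}_n=n$, leading coefficient $c_n^{(\ell)}>0$); $P_n^{(\ell)}$ has $n$ simple zeros $1<x_{1,n}^{(\ell)}<\dots<x_{n,n}^{(\ell)}$. Put $a_n^{(\ell)}=c_n^{(\ell)}/c_{n+1}^{(\ell)}$, $b_n^{(\ell)}=(xP_n^{(\ell)},P_n^{(\ell)})_{\omega^{(\ell)}}$, $p_n=c_n^{(0)}/c_n^{(1)}$, $q_n=\frac{c_n^{(1)}}{c_{n+1}^{(0)}}\big(\sum_{i=1}^{n+2}x_{i,n+2}^{(0)}-\sum_{i=1}^nx_{i,n}^{(1)}\big)$,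 $r_n=c_{n-1}^{(1)}/c_{n+1}^{(0)}$ ($n\ge1$). **Matrices.** $\vec J_n^{(\ell)}$ is the $(n+1)\times(n+1)$ symmetric tridiagonal matrix with diagonal $b_0^{(\ell)},\dots,b_n^{(\ell)}$ and off-diagonal $a_0^{(\ell)},\dots,a_{n-1}^{(\ell)}$. $\vec J_{n}$ is the $(n+1)\times(n+2)$ matrix whose entries (rows $k=0,\dots,n$, columns $j=0,\dots,n+1$) are $p_k$ at $(k,k)$, $q_k$ at $(k,k+1)$, $r_{k+1}$ at $(k,k+2)$ when $k+2\le n+1$, and $0$ otherwise. Define the $(2M+1)\times(2M+1)$ matrices $$\vec A_M^0=\begin{pmatrix}\vec J_M^{(0)}&0\\0&\vec J_{M-1}^{(1)}\end{pmatrix},\qquad \vec A_M^1=\begin{pmatrix}0&\vec J_{M-1}^T\\ \vec J_{M-1}&0\end{pmatrix}.$$ **Weighted basis.** For $|u|<1$, $\theta>0$ set $\zeta=1/\theta$, $U^0=(1-u^2)^{-1/2}$, $U^1=uU^0$; for $p\in\mathbb R$ set $p^0=\sqrt{1+p^2}$, $E=U^0p^0-U^1p$, $p_{<1>}=-p+U^1E$, $g_{[u,\theta]}=\frac1{2K_1(\zeta)}e^{-\zeta E}$. Let $\tilde P_k^{(0)}[u,\theta]=g_{[u,\theta]}P_k^{(0)}(E;\zeta)$, $\tilde P_k^{(1)}[u,\theta]=g_{[u,\theta]}P_k^{(1)}(E;\zeta)\,p_{<1>}/U^0$. Let $\vec{\mathcal P}_M=(\tilde P_0^{(0)},\tilde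 P_1^{(0)},\tilde P_0^{(1)},\tilde P_2^{(0)},\tilde P_1^{(1)},\dots,\tilde P_M^{(0)},\tilde P_{M-1}^{(1)})^T$; its components are orthonormal for $\langle f,h\rangle=\int_{\mathbb R}\frac{fh}{g_{[u,\theta]}}\frac{dp}{p^0}$. $\vec P_M^p$ is the permutation matrix with $\vec P_M^p(\tilde P_0^{(0)},\dots,\tilde P_M^{(0)},\tilde P_0^{(1)},\dots,\tilde P_{M-1}^{(1)})^T=\vec{\mathcal P}_M$. **Moment system (order $M$).** Unknowns: $\vec W_M=(\rho,u,\theta,\Pi,\tilde n^1,f_3^0,f_2^1,\dots,f_M^0,f_{M-1}^1)^T\in\mathbb R^{2M+1}$ ($\vec W_1=(\rho,u,\theta)^T$, $\vec W_2=(\rho,u,\theta,\Pi,\tilde n^1)^T$). To $\vec W_M$ associate $\vec f_M=(f_0^0,f_1^0,f_0^1,f_2^0,f_1^1,\dots,f_M^0,f_{M-1}^1)^T$: for $M=1$, $\vec f_1=(\rho/c_0^{(0)},0,0)^T$; for $M\ge2$, $f_0^0=\rho/c_0^{(0)}-c_0^{(0)}\Pi$, $f_1^0=c_1^{(0)}x_{1,1}^{(0)}\Pi$, $f_0^1=-c_0^{(1)}\tilde n^1$, $f_2^0=-c_2^{(0)}x_{1,2}^{(0)}x_{2,2}^{(0)}\Pi$, $f_1^1=c_1^{(1)}x_{1,1}^{(1)}\tilde n^1$ (all coefficients at $\zeta=1/\theta$), the remaining components being those of $\vec W_M$. Let $F(\vec W_M;p)=\vec{\mathcal P}_M[u,\theta]^T\vec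 f_M$. $\vec D_M=\vec D_M(\vec W_M)$ is the $(2M+1)\times(2M+1)$ matrix with $(\vec D_M)_{kj}=\langle\partial F/\partial W_j,(\vec{\mathcal P}_M)_k\rangle$ (the coefficients of the orthogonal projection of $\partial F/\partial W_j$ on the span of $\vec{\mathcal P}_M$). Further $$\vec M_M^t=\vec P_M^p(U^0\vec A_M^0-U^1\vec A_M^1)(\vec P_M^p)^T,\quad \vec M_M^x=\vec P_M^p(U^1\vec A_M^0-U^0\vec A_M^1)(\vec P_M^p)^T,$$ $\vec B_M^0=\vec M_M^t\vec D_M$, $\vec B_M^1=\vec M_M^x\vec D_M$; the source $\vec S$ plays no role here. **Admissible states.** $\mathcal G_M$ is the set of $\vec W_M$ with $\rho>0$, $|u|<1$, $\theta>0$ and, if $M\ge2$, $\Pi>-\rho\theta$; on $\mathcal G_M$ the matrix $\vec D_M$ is invertible. **The $0$-th characteristic field.** The eigenvalue is $\lambda_{0,M}(\vec W_M)=\frac{u-\hat\lambda_{0,M}}{1-u\hat\lambda_{0,M}}$ with $\hat\lambda_{0,M}=0$ (the zero generalized eigenvalue of $\vec A_M^1\vec y=\hat\lambda\vec A_M^0\vec y$), with eigenvector ($\lambda_{0,M}\vec B_M^0\vec r_{0,M}=\vec B_M^1\vec r_{0,M}$) $\vec r_{0,M}=\vec D_M^{-1}\vec P_M^p\vec y_{0,M}$, where $\vec y_{0,M}=(\vec u_{0,M}^T,\vec 0^T)^T$, $\vec u_{0,M}=\vec P_M^{(0)}(1;\zeta)P_{M+1}^{(0)}(-1;\zeta)-\vec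 P_M^{(0)}(-1;\zeta)P_{M+1}^{(0)}(1;\zeta)\in\mathbb R^{M+1}$, $\vec P_M^{(0)}=(P_0^{(0)},\dots,P_M^{(0)})^T$, and $\vec 0\in\mathbb R^M$. *)

(* Defs.v *)
From HB Require Import structures.
From mathcomp Require Import all_boot all_order all_algebra.
From mathcomp Require Import all_classical all_reals all_analysis.
From mathcomp Require Import polyrcf.

Set Implicit Arguments.
Unset Strict Implicit.
Unset Printing Implicit Defensive.

Import Order.TTheory GRing.Theory Num.Theory.
Import numFieldNormedType.Exports.

Local Open Scope classical_set_scope.
Local Open Scope ring_scope.

(* Throughout, the superscript (l) with l in {0,1} is a boolean: (0) is
   [false], (1) is [true], and [l%:R] is its numerical value. *)

Definition besselK (R : realType) (n : nat) (zeta : R) : R :=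
  \int[lebesgue_measure]_(t in `[0, +oo[)
     ((expR (n%:R * t) + expR (- (n%:R * t))) / 2
      * expR (- zeta * ((expR t + expR (- t)) / 2))).

(* At x = 1 and l = 0 the real power is total and yields 0 instead of
   +oo; this is a Lebesgue-null set. *)
Definition omega (R : realType) (l : bool) (zeta x : R) : R :=
  (besselK 1 zeta)^-1 * ((x ^+ 2 - 1) `^ (l%:R - 2^-1)) * expR (- zeta * x).

Definition innerw (R : realType) (l : bool) (zeta : R) (f g : R -> R) : R :=
  \int[lebesgue_measure]_(x in `[1, +oo[) (f x * g x * omega l zeta x).

Definition orthonormal_polys (R : realType) (l : bool) (zeta : R)
    (Q : nat -> {poly R}) : Prop :=
  [/\ forall n, size (Q n) = n.+1,
      forall n, 0 < lead_coef (Q n) &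
      forall m n, innerw l zeta (horner (Q m)) (horner (Q n)) = (m == n)%:R].

(* [P l zeta n] stands for P_n^{(l)}(. ; zeta). *)
Definition is_poly_family (R : realType) (P : bool -> R -> nat -> {poly R}) :=
  forall (l : bool) (zeta : R), 0 < zeta -> orthonormal_polys l zeta (P l zeta).

Section Coefficients.
Context (R : realType) (P : bool -> R -> nat -> {poly R}).

Definition cc (l : bool) (zeta : R) (n : nat) : R := lead_coef (P l zeta n).

(* The i-th zero, counted from i = 1 in increasing order. *)
Definition xx (l : bool) (zeta : R) (i n : nat) : R :=
  (rootsR (P l zeta n))`_(i.-1).

Definition aa (l : bool) (zeta : R) (n : nat) : R :=
  cc l zeta n / cc l zeta n.+1.

Definition bb (l : bool) (zeta : R) (n : nat) : R :=
  innerw l zeta (horner ('X * P l zeta n)) (horner (P l zeta n)).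

Definition pp (zeta : R) (n : nat) : R := cc false zeta n / cc true zeta n.

Definition qq (zeta : R) (n : nat) : R :=
  cc true zeta n / cc false zeta n.+1
  * (\sum_(1 <= i < n.+3) xx false zeta i n.+2
     - \sum_(1 <= i < n.+1) xx true zeta i n).

(* Only meaningful for n >= 1. *)
Definition rr (zeta : R) (n : nat) : R := cc true zeta n.-1 / cc false zeta n.+1.

(* The index is the size: this is J^{(l)}_{m-1}. *)
Definition Jsym (l : bool) (zeta : R) (m : nat) : 'M[R]_m :=
  \matrix_(i, j)
    if i == j :> nat then bb l zeta i
    else if j == i.+1 :> nat then aa l zeta i
    else if i == j.+1 :> nat then aa l zeta j
    else 0.

(* The index is the number of rows: this is J_{m-1}. *)
Definition Jmix (zeta : R) (m : nat) : 'M[R]_(m, m.+1) :=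
  \matrix_(k, j)
    if j == k :> nat then pp zeta k
    else if j == k.+1 :> nat then qq zeta k
    else if j == k.+2 :> nat then rr zeta k.+1
    else 0.

Definition A0 (zeta : R) (M : nat) : 'M[R]_(M.+1 + M) :=
  block_mx (Jsym false zeta M.+1) 0 0 (Jsym true zeta M).

Definition A1 (zeta : R) (M : nat) : 'M[R]_(M.+1 + M) :=
  block_mx 0 (Jmix zeta M)^T (Jmix zeta M) 0.

End Coefficients.

Section Basis.
Context (R : realType) (P : bool -> R -> nat -> {poly R}).

Definition U0 (u : R) : R := (Num.sqrt (1 - u ^+ 2))^-1.
Definition U1 (u : R) : R := u * U0 u.
Definition p0 (p : R) : R := Num.sqrt (1 + p ^+ 2).
Definition EE (u p : R) : R := U0 u * p0 p - U1 u * p.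
Definition pperp (u p : R) : R := - p + U1 u * EE u p.

Definition gg (u theta p : R) : R :=
  (2 * besselK 1 theta^-1)^-1 * expR (- theta^-1 * EE u p).

Definition Ptilde (u theta : R) (l : bool) (n : nat) (p : R) : R :=
  gg u theta p * (P l theta^-1 n).[EE u p]
  * (if l then pperp u p / U0 u else 1).

(* The k-th component of the weighted basis is Ptilde_n^{(l)} with
   (l, n) = slot k, i.e. the order is
   (0,0), (0,1), (1,0), (0,2), (1,1), (0,3), (1,2), ... *)
Definition slot (k : nat) : bool * nat :=
  if (k == 0%N) || odd k then (false, uphalf k) else (true, k./2.-1).

Definition basis (u theta : R) (k : nat) (p : R) : R :=
  Ptilde u theta (slot k).1 (slot k).2 p.

(* Rows are indexed by the order of [slot], columns by the block order
   (0,0), ..., (0,M), (1,0), ..., (1,M-1). *)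
Definition Pperm (M : nat) : 'M[R]_(M.+1 + M) :=
  \matrix_(k, i) (slot k == match fintype.split i with
                            | inl n => (false, n : nat)
                            | inr n => (true, n : nat)
                            end)%:R.

Definition innerp (u theta : R) (f h : R -> R) : R :=
  \int[lebesgue_measure]_p (f p * h p / gg u theta p / p0 p).

End Basis.

Section MomentSystem.
Context (R : realType) (P : bool -> R -> nat -> {poly R}) (M : nat).
Local Notation state := 'cV[R]_(M.+1 + M).

(* Component k of W, or 0 when W has no such component. *)
Definition entry (W : state) (k : nat) : R :=
  if insub k is Some i then W i 0 else 0.

(* rho, u, theta, Pi, n^1 (tilde), zeta = 1/theta. *)
Definition rho (W : state) : R := entry W 0.
Definition vel (W : state) : R := entry W 1.
Definition theta (W : state) : R := entry W 2.
Definition bulk (W : state) : R := entry W 3.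
Definition heat (W : state) : R := entry W 4.
Definition zeta (W : state) : R := (theta W)^-1.

(* The coefficients f_M for M = 1 and for M >= 2. *)
Definition coeff1 (W : state) (k : nat) : R :=
  if k == 0%N then rho W / cc P false (zeta W) 0 else 0.

Definition coeff2 (W : state) (k : nat) : R :=
  let c l n := cc P l (zeta W) n in
  let x l i n := xx P l (zeta W) i n in
  match k with
  | 0 => rho W / c false 0%N - c false 0%N * bulk W
  | 1 => c false 1%N * x false 1%N 1%N * bulk W
  | 2 => - c true 0%N * heat W
  | 3 => - c false 2%N * x false 1%N 2%N * x false 2%N 2%N * bulk W
  | 4 => c true 1%N * x true 1%N 1%N * heat W
  | _ => entry W k
  end.

Definition coeff (W : state) : state :=
  \col_k (if M == 1%N then coeff1 W k else coeff2 W k).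

Definition FF (W : state) (p : R) : R :=
  \sum_(k < M.+1 + M) basis P (vel W) (theta W) k p * coeff W k 0.

Definition DD (W : state) : 'M[R]_(M.+1 + M) :=
  \matrix_(k, j)
    innerp (vel W) (theta W)
      (fun p => 'D_(delta_mx j 0) (fun W' : state => (FF W' p : R^o)) W)
      (basis P (vel W) (theta W) k).

Definition Mt (W : state) : 'M[R]_(M.+1 + M) :=
  Pperm R M *m (U0 (vel W) *: A0 P (zeta W) M - U1 (vel W) *: A1 P (zeta W) M)
  *m (Pperm R M)^T.

Definition Mx (W : state) : 'M[R]_(M.+1 + M) :=
  Pperm R M *m (U1 (vel W) *: A0 P (zeta W) M - U0 (vel W) *: A1 P (zeta W) M)
  *m (Pperm R M)^T.

Definition B0 (W : state) : 'M[R]_(M.+1 + M) := Mt W *m DD W.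
Definition B1 (W : state) : 'M[R]_(M.+1 + M) := Mx W *m DD W.

Definition admissible : set state :=
  [set W | [/\ 0 < rho W, `|vel W| < 1, 0 < theta W &
               (2 <= M)%N -> - (rho W * theta W) < bulk W]].

Definition hatlambda0 : R := 0.

Definition lambda0 (W : state) : R :=
  (vel W - hatlambda0) / (1 - vel W * hatlambda0).

Definition y0 (W : state) : state :=
  let Q n x := (P false (zeta W) n).[x] in
  col_mx (\col_(i < M.+1) (Q i 1 * Q M.+1 (-1) - Q i (-1) * Q M.+1 1)) 0.

Definition r0 (W : state) : state := invmx (DD W) *m (Pperm R M *m y0 W).

End MomentSystem.

Section CharacteristicFields.
Context (R : realType) (n : nat).

(* lam and r are, on G, an eigenvalue and an eigenvector of the system
   B0 d_t W + B1 d_x W = S(W). *)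
Definition characteristic_field (G : set 'cV[R]_n) (C0 C1 : 'cV[R]_n -> 'M[R]_n)
    (lam : 'cV[R]_n -> R) (r : 'cV[R]_n -> 'cV[R]_n) : Prop :=
  forall W, G W -> r W != 0 /\ lam W *: (C0 W *m r W) = C1 W *m r W.

Definition gradient (f : 'cV[R]_n -> R) (W : 'cV[R]_n) : 'rV[R]_n :=
  \row_j 'D_(delta_mx j 0) (f : 'cV[R]_n -> R^o) W.

Definition linearly_degenerate (G : set 'cV[R]_n)
    (lam : 'cV[R]_n -> R) (r : 'cV[R]_n -> 'cV[R]_n) : Prop :=
  forall W, G W -> \sum_j gradient lam W 0 j * r W j 0 = 0.

End CharacteristicFields.

(* Main.v *)
Require Import Defs.
From HB Require Import structures.
From mathcomp Require Import all_boot all_order all_algebra.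
From mathcomp Require Import all_classical all_reals all_analysis.
From mathcomp Require Import measurable_realfun polyrcf ring lra zify.

Set Implicit Arguments.
Unset Strict Implicit.
Unset Printing Implicit Defensive.

Import Order.TTheory GRing.Theory Num.Theory.
Import numFieldNormedType.Exports.

Local Open Scope classical_set_scope.
Local Open Scope ring_scope.

(** The eigenvalue of the zeroth field is the velocity, so the theorem says that
    the vector [r0], defined through the inverse of the projected derivative
    [DD], is an eigenvector whose velocity component vanishes.

    That [y0] is annihilated by the off-diagonal matrix is the recurrence
    [christoffel], which expands [(x ^ 2 - 1) * P true z k] in the [P false z n]:
    its left-hand side vanishes at 1 and at -1, and the combination in [y0] of
    the values at these two points removes the term lost by truncation
    ([Jmix_uvec]). As all zeros are greater than 1, [y0] is not 0.

    It remains to solve [DD v = w]. Let E be the comoving energy [EE] and Q the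
    comoving momentum [QQ]; then [E ^ 2 = 1 + Q ^ 2], the measure dp / p0 p is
    invariant under boosts, and the distribution is [expR (- z * E) / 2] times
    [A(E) + Q * B(E)] for polynomials A and B that depend on the state and, through
    the orthonormal polynomials, on the inverse temperature [z]. Hence every
    entry of [DD] is a value of a single functional on polynomials, [eform]
    ([DD_eform]).

    The unknowns are chosen so that the low moments of the distribution are
    simple: with <b> the normalised functional, the moment of b(E) is
    [rho * <b> - bulk * b(0)] if b has degree at most 2, and that of Q * b(E) is
    [- heat * b(0)] if b has degree at most 1 ([statepoly_test]). A derivative in
    the temperature is obtained by differentiating these identities, which needs
    the differentiability of the polynomials in [z] ([pdiff_P], by Gram-Schmidt).
    A derivative in the velocity acts as the derivation E' = Q, Q' = E, which an
    integration by parts moves to the test function ([eform_by_parts]). Tested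
    against Q * E, only the velocity survives, with the factor
    [rho * (<E ^ 2> + theta) + bulk] up to sign, which is positive for admissible
    states ([vel_component0]). Since [y0] has no component on the odd test
    functions, [r0] has no velocity component. Testing against E, E ^ 2, 1 and Q
    in turn shows that [DD] is injective ([DD_inj]): the temperature is recovered
    because, by the strict Cauchy-Schwarz inequality [mom_log_convex], <E ^ 2> is
    strictly monotone in it. For [M = 1] the tests are Q, E and 1. *)

(** * Moments of the relativistic weight *)

Section Energy.
Context {R : realType}.
Implicit Types q : R.

Lemma sqr_p0 q : p0 q ^+ 2 = 1 + q ^+ 2.
Proof. by rewrite sqr_sqrtr// addr_ge0// sqr_ge0. Qed.

Lemma p0_gt0 q : 0 < p0 q.
Proof. by rewrite sqrtr_gt0 ltr_wpDr// sqr_ge0. Qed.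

Lemma p0_neq0 q : p0 q != 0. Proof. exact/lt0r_neq0/p0_gt0. Qed.

Lemma p0_ge1 q : 1 <= p0 q.
Proof. by rewrite -[leLHS]sqrtr1 ler_sqrt ?lerDl ?sqr_ge0// addr_ge0// sqr_ge0. Qed.

Lemma p0_ge_norm q : `|q| <= p0 q.
Proof. by rewrite -sqrtr_sqr ler_sqrt ?lerDr// addr_ge0// sqr_ge0. Qed.

Lemma p0N q : p0 (- q) = p0 q.
Proof. by rewrite /p0 sqrrN. Qed.

Global Instance is_derive_p0 q : is_derive q 1 (@p0 R) (q / p0 q).
Proof.
have h : 0 < 1 + q ^+ 2 by rewrite ltr_wpDr// sqr_ge0.
have hc : is_derive q 1 (fun x : R => 1 + x ^+ 2) (2 * q).
  by apply: is_derive_eq; rewrite /GRing.scale/=; ring.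
have hs := is_derive1_sqrt h.
have hd := @is_derive1_comp R (@Num.sqrt R) (fun x : R => 1 + x ^+ 2) q _ _ hs hc.
suff <- : (2 * p0 q)^-1 * (2 * q) = q / p0 q by exact: hd.
by field; exact: p0_neq0.
Qed.

Lemma continuous_p0 : continuous (@p0 R).
Proof.
by move=> q; apply/differentiable_continuous/derivable1_diffP.
Qed.

(** Dividing by [p0 q] turns Lebesgue measure into the Lorentz-invariant one. *)
Definition kern (k : nat) (z q : R) := p0 q ^+ k * expR (- z * p0 q) / p0 q.

Lemma kern_ge0 k z q : 0 <= kern k z q.
Proof. by rewrite divr_ge0 ?mulr_ge0 ?exprn_ge0 ?expR_ge0 ?ltW ?p0_gt0. Qed.

Lemma continuous_kern k z : continuous (kern k z).
Proof.
move=> q; apply: cvgM; last by apply: cvgV; [exact: p0_neq0|exact: continuous_p0].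
apply: cvgM.
  apply: (@continuous_comp _ _ _ (@p0 R) (fun x => x ^+ k)); first exact: continuous_p0.
  exact: exprn_continuous.
apply: (@continuous_comp _ _ _ (fun x => - z * p0 x) expR).
  by apply: cvgM; [exact: cvg_cst|exact: continuous_p0].
exact: continuous_expR.
Qed.

Lemma measurable_kern k z (D : set R) : measurable_fun D (kern k z).
Proof. by apply: measurable_funTS; apply: continuous_measurable_fun; exact: continuous_kern. Qed.

Lemma expR_ge_pow (x : R) n : 0 <= x -> x ^+ n <= n`!%:R * expR x.
Proof.
move=> x0; case: n => [|n]; first by rewrite expr0 fact0 mul1r; apply: le_trans (expR_ge1Dx x); lra.
rewrite mulrC -ler_pdivrMr ?ltr0n ?fact_gt0//.
by apply: le_trans (expR_ge1Dxn n x0); rewrite lerDr.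
Qed.

(** Half of the exponential absorbs the power. *)
Lemma pow_expR_le (z x : R) n : 0 < z -> 0 <= x ->
  x ^+ n * expR (- z * x) <= n`!%:R * (2 / z) ^+ n * expR (- (z / 2) * x).
Proof.
move=> z0 x0.
have h : - z * x = - (z / 2 * x) + - (z / 2) * x by field.
rewrite h expRD mulrA ler_wpM2r ?expR_ge0// expRN -ler_pdivlMr ?invr_gt0 ?expR_gt0//.
rewrite invrK.
have := @expR_ge_pow (z / 2 * x) n (mulr_ge0 (divr_ge0 (ltW z0) (ler0n _ _)) x0).
rewrite exprMn -ler_pdivlMl ?exprn_gt0 ?divr_gt0//.
rewrite -exprVn invf_div; nra.
Qed.

Lemma integrable_expR (c : R) : 0 < c ->
  lebesgue_measure.-integrable `[0, +oo[ (EFin \o (fun q => expR (- c * q))).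
Proof.
move=> c0.
have h : lebesgue_measure.-integrable `[0%R, +oo[ (EFin \o exponential_pdf c).
  apply: (integrableS measurableT) => //.
  exact: integrable_exponential_pdf.
have := @integrableZl _ _ _ lebesgue_measure _ _ c^-1 _ h => /(_ (measurable_itv _)).
apply: eq_integrable => //.
move=> q; rewrite inE/= in_itv/= andbT => q0.
rewrite exponential_pdfE// -EFinM mulrA mulVf ?gt_eqF//.
by rewrite mul1r.
Qed.

Lemma kern_bound k z q : 0 < z -> 0 <= q ->
  kern k z q <= k`!%:R * (2 / z) ^+ k * expR (- (z / 2) * q).
Proof.
move=> z0 q0; rewrite /kern.
apply: (@le_trans _ _ (p0 q ^+ k * expR (- z * p0 q))).
  rewrite ler_pdivrMr ?p0_gt0// ler_peMr ?p0_ge1// mulr_ge0 ?expR_ge0//.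
  by rewrite exprn_ge0// ltW// p0_gt0.
apply: le_trans (pow_expR_le k z0 (ltW (p0_gt0 q))) _.
rewrite ler_wpM2l ?mulr_ge0 ?exprn_ge0 ?divr_ge0 ?(ltW z0)//.
by rewrite ler_expR !mulNr lerN2 ler_wpM2l ?divr_ge0 ?(ltW z0)// (le_trans (ler_norm _))// p0_ge_norm.
Qed.

Lemma integrable_kern k z : 0 < z ->
  lebesgue_measure.-integrable `[0, +oo[ (EFin \o kern k z).
Proof.
move=> z0; set C : R := k`!%:R * (2 / z) ^+ k.
apply: (@le_integrable _ _ _ lebesgue_measure _ _ _
  (fun q => (C%:E * (expR (- (z / 2) * q))%:E)%E)) => //.
- by apply/measurable_EFinP; exact: measurable_kern.
- move=> q; rewrite /= in_itv/= andbT => q0.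
  rewrite lee_fin !ger0_norm ?kern_ge0 ?kern_bound//.
  by rewrite mulr_ge0 ?expR_ge0 ?mulr_ge0 ?exprn_ge0 ?divr_ge0 ?(ltW z0).
- by apply: integrableZl => //; apply: integrable_expR; rewrite divr_gt0.
Qed.

Definition mom (z : R) (k : nat) : R :=
  \int[lebesgue_measure]_(q in `[0, +oo[) kern k z q.

Lemma kernS k z q : kern k.+1 z q = p0 q * kern k z q.
Proof. by rewrite /kern exprS; ring. Qed.

Lemma is_derive_kern k q (z : R) :
  is_derive z 1 (fun y => kern k y q) (- kern k.+1 z q).
Proof.
rewrite /kern; apply: is_derive_eq.
rewrite /GRing.scale/= exprS; field; exact: p0_neq0.
Qed.

(** For parameters above [z / 2] the derivative of the integrand is dominated by
    its absolute value at [z / 2]. *)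
Lemma is_derive_mom (z : R) k : 0 < z ->
  is_derive z 1 (fun y => mom y k) (- mom z k.+1).
Proof.
move=> z0.
have z20 : 0 < z / 2 by rewrite divr_gt0.
have hz : `](z / 2), (2 * z)[%classic z by rewrite /= in_itv/=; apply/andP; split; lra.
have dE x q : partial1of2 (fun y q => kern k y q) x q = - kern k.+1 x q.
  by rewrite partial1of2E; apply: derive_val; exact: is_derive_kern.
have H := @cvg_differentiation_under_integral R _ _ lebesgue_measure
  (fun y q => kern k y q) `[0%R, +oo[ (measurable_itv _) z (z / 2) (2 * z) hz
  _ _ (kern k.+1 (z / 2)) (kern_ge0 _ _) (integrable_kern _ z20) _.
have {}H : h^-1 *: (mom (h + z) k - mom z k) @[h --> 0^'] --> - mom z k.+1.
  rewrite (_ : - mom z k.+1 = \int[lebesgue_measure]_(y in `[0%R, +oo[)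
     partial1of2 (fun y q => kern k y q) z y); last first.
    rewrite (_ : - _ = (-1) * mom z k.+1); last by rewrite mulN1r.
    rewrite /mom -RintegralZl//; last exact: integrable_kern.
    by apply: eq_Rintegral => q _; rewrite dE mulN1r.
  apply: H.
  - move=> x; rewrite /= in_itv/= => /andP[hx _]; apply: integrable_kern.
    exact: lt_trans hx.
  - by move=> x q _ _; have [] := is_derive_kern k q x.
  - move=> x q; rewrite /= in_itv/= => /andP[hx _] _.
    rewrite dE normrN ger0_norm ?kern_ge0// /kern ler_wpM2r ?invr_ge0 ?(ltW (p0_gt0 _))//.
    rewrite ler_wpM2l ?exprn_ge0 ?(ltW (p0_gt0 _))//.
    by rewrite ler_expR ler_wpM2r ?(ltW (p0_gt0 _))// lerN2 ltW.
have {}H : h^-1 *: (mom (h *: (1:R) + z) k - mom z k) @[h --> 0^'] --> - mom z k.+1.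
  by under eq_fun do rewrite scaler1.
split; first by apply/cvg_ex; exists (- mom z k.+1).
exact/cvg_lim.
Qed.

End Energy.

(** * Integration by parts *)

Section IntegrationByParts.
Context {R : realType}.

Lemma Rintegral_is_derive_ge0 (f F : R -> R) (l : R) :
  (forall x : R, is_derive x 1 F (f x)) -> continuous f ->
  (forall x, 0 <= x -> 0 <= f x) -> F x @[x --> +oo] --> l ->
  \int[lebesgue_measure]_(x in `[0, +oo[) f x = l - F 0.
Proof.
move=> dF cf f0 Fl.
apply: Rintegral_ge0_continuous_FTC2y => //.
- exact: continuous_subspaceT.
- apply: cvg_at_right_filter; apply: differentiable_continuous.
  by apply/derivable1_diffP; have [] := dF 0.
- by move=> x _; rewrite derive1E; apply: derive_val; exact: dF.
Qed.

Lemma cvg_expRNM (c : R) : 0 < c -> expR (- c * x) @[x --> +oo] --> (0 : R).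
Proof.
move=> c0.
rewrite (_ : (fun x => expR (- c * x)) = (fun z => expR (- z)) \o (fun z => c * z)); last first.
  by apply: eq_fun => x; rewrite mulNr.
apply: (@cvg_comp _ _ _ _ _ _ (pinfty_nbhs R)); last exact: cvgr_expR.
exact: gt0_cvgMry.
Qed.

Lemma is_derive_expRNM (c q : R) :
  is_derive q 1 (fun x => expR (- c * x)) (- c * expR (- c * q)).
Proof. by apply: is_derive_eq; rewrite /GRing.scale/=; ring. Qed.

Lemma continuous_expRNM (c : R) : continuous (fun x => expR (- c * x)).
Proof.
move=> q; apply: differentiable_continuous; apply/derivable1_diffP.
by have [] := is_derive_expRNM c q.
Qed.

(** The boundary terms of [q * expR (- z * p0 q)] vanish; as that function is
    not monotone, a multiple of [expR (- (z / 2) * q)] is subtracted from it to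
    make the integrand nonnegative. *)
Lemma mom_by_parts (z : R) : 0 < z -> mom z 1 = z * (mom z 2 - mom z 0).
Proof.
move=> z0; have z20 : 0 < z / 2 by rewrite divr_gt0.
pose f q : R := kern 1 z q - z * (kern 2 z q - kern 0 z q).
pose e q : R := expR (- (z / 2) * q).
have fE q : f q = expR (- z * p0 q) * (1 - z * q ^+ 2 / p0 q).
  rewrite /f /kern.
  have -> : q ^+ 2 = p0 q ^+ 2 - 1 by rewrite sqr_p0; ring.
  by field; exact: p0_neq0.
have qe q : 0 <= q -> p0 q * expR (- z * p0 q) <= 2 / z * e q.
  move=> q0; have := pow_expR_le 1 z0 (ltW (p0_gt0 q)).
  rewrite !expr1 (_ : 1`!%:R = 1)// mul1r => /le_trans; apply.
  rewrite ler_wpM2l ?divr_ge0 ?(ltW z0)// ler_expR !mulNr lerN2.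
  by rewrite ler_wpM2l ?(ltW z20)// (le_trans (ler_norm _))// p0_ge_norm.
have ie : lebesgue_measure.-integrable `[0, +oo[ (EFin \o e) by exact: integrable_expR.
have i2e : lebesgue_measure.-integrable `[0, +oo[ (EFin \o (fun q => 2 * e q)).
  exact: (@integrableZl _ _ _ lebesgue_measure _ (measurable_itv _) 2 _ ie).
have ce : \int[lebesgue_measure]_(q in `[0, +oo[) e q = 2 / z.
  transitivity (0 - - (2 / z) * e 0); last by rewrite /e mulr0 expR0; ring.
  apply: (@Rintegral_is_derive_ge0 e (fun q => - (2 / z) * e q)).
  - move=> x; apply: is_derive_eq; rewrite /GRing.scale/= -/(e x); field.
    by rewrite gt_eqF.
  - exact: continuous_expRNM.
  - by move=> x _; rewrite expR_ge0.
  - rewrite -[X in _ --> X](mulr0 (- (2 / z))); apply: cvgM; first exact: cvg_cst.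
    exact: cvg_expRNM.
have ik k : lebesgue_measure.-integrable `[0, +oo[ (EFin \o kern k z).
  exact: integrable_kern.
have i20 : lebesgue_measure.-integrable `[0, +oo[ (EFin \o (fun q => kern 2 z q - kern 0 z q)).
  exact: (@integrableB _ _ _ lebesgue_measure _ (measurable_itv _) _ _ (ik 2) (ik 0)).
have iz20 : lebesgue_measure.-integrable `[0, +oo[ (EFin \o (fun q => z * (kern 2 z q - kern 0 z q))).
  exact: (@integrableZl _ _ _ lebesgue_measure _ (measurable_itv _) z _ i20).
have if_ : lebesgue_measure.-integrable `[0, +oo[ (EFin \o f).
  exact: (@integrableB _ _ _ lebesgue_measure _ (measurable_itv _) _ _ (ik 1%N) iz20).
have : \int[lebesgue_measure]_(q in `[0, +oo[) (f q + 2 * e q) = 2 * (2 / z).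
  pose F q := q * expR (- z * p0 q) - 2 * (2 / z) * e q.
  transitivity (0 - F 0); last by rewrite /F /e !mulr0 expR0 mul0r; ring.
  apply: (@Rintegral_is_derive_ge0 _ F).
  - move=> q; rewrite fE; apply: is_derive_eq.
    rewrite /GRing.scale/= -/(e q); field.
    by rewrite p0_neq0 gt_eqF.
  - move=> q; apply: cvgD; last first.
      by apply: cvgM; [exact: cvg_cst|exact: continuous_expRNM].
    apply: cvgB; first exact: continuous_kern.
    apply: cvgM; first exact: cvg_cst.
    by apply: cvgB; exact: continuous_kern.
  - move=> q q0; rewrite fE.
    have h : expR (- z * p0 q) * (z * q ^+ 2 / p0 q) <= 2 * e q.
      have -> : 2 * e q = z * (2 / z * e q) by field; rewrite gt_eqF.
      have -> : expR (- z * p0 q) * (z * q ^+ 2 / p0 q)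
        = z * (q ^+ 2 / p0 q * expR (- z * p0 q)) by ring.
      rewrite ler_pM2l//.
      apply: le_trans (qe q q0); rewrite ler_wpM2r ?expR_ge0//.
      rewrite ler_pdivrMr ?p0_gt0// -expr2 sqr_p0; lra.
    rewrite mulrBr mulr1; have := expR_ge0 (- z * p0 q); lra.
  - rewrite -[X in _ --> X](subr0 0); apply: cvgB; last first.
      rewrite -[X in _ --> X](mulr0 (2 * (2 / z))); apply: cvgM; first exact: cvg_cst.
      exact: cvg_expRNM.
    apply: (@squeeze_cvgr _ _ _ _ (fun=> 0) (fun q => 2 / z * e q)).
    + near=> q; have q0 : 0 <= q by near: q; exact: nbhs_pinfty_ge.
      rewrite mulr_ge0 ?expR_ge0//=; apply: le_trans (qe q q0).
      by rewrite ler_wpM2r ?expR_ge0// (le_trans (ler_norm _))// p0_ge_norm.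
    + exact: cvg_cst.
    + rewrite -[X in _ --> X](mulr0 (2 / z)); apply: cvgM; first exact: cvg_cst.
      exact: cvg_expRNM.
rewrite RintegralD//= RintegralZl// ce /f RintegralB// RintegralZl// RintegralB//.
rewrite -/(mom z 1) -/(mom z 2) -/(mom z 0); lra.
Unshelve. all: by end_near. Qed.

End IntegrationByParts.

(** * The energy functional on polynomials *)

Section MomentFunctional.
Context {R : comNzRingType}.
Implicit Types (m : nat -> R) (r s : {poly R}).

(** The linear functional on polynomials with prescribed moments. *)
Definition momform m r : R := \sum_(i < size r) r`_i * m i.

Lemma momform_wide m r N : (size r <= N)%N -> momform m r = \sum_(i < N) r`_i * m i.
Proof.
move=> rN; rewrite /momform (big_ord_widen N (fun i => r`_i * m i) rN) big_mkcond/=.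
apply: eq_bigr => i _; case: ifPn => //; rewrite -leqNgt => ri.
by rewrite nth_default// mul0r.
Qed.

Lemma momformD m r s : momform m (r + s) = momform m r + momform m s.
Proof.
pose N := maxn (size r) (size s).
rewrite !(@momform_wide _ _ N) ?leq_maxl ?leq_maxr// ?size_polyD// -big_split/=.
by apply: eq_bigr => i _; rewrite coefD mulrDl.
Qed.

Lemma momformZ m a r : momform m (a *: r) = a * momform m r.
Proof.
rewrite !(@momform_wide _ _ (size r)) ?size_scale_leq// mulr_sumr.
by apply: eq_bigr => i _; rewrite coefZ mulrA.
Qed.

Lemma momform0 m : momform m 0 = 0. Proof. by rewrite /momform size_poly0 big_ord0. Qed.

Lemma momformN m r : momform m (- r) = - momform m r.
Proof. by rewrite -scaleN1r momformZ mulN1r. Qed.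

Lemma momformB m r s : momform m (r - s) = momform m r - momform m s.
Proof. by rewrite momformD momformN. Qed.

Lemma momform_sum m I (t : seq I) (Q : pred I) (F : I -> {poly R}) :
  momform m (\sum_(i <- t | Q i) F i) = \sum_(i <- t | Q i) momform m (F i).
Proof. by elim/big_rec2: _ => [|i x y _ <-]; rewrite ?momform0 ?momformD. Qed.

Lemma momformXn m n : momform m 'X^n = m n.
Proof.
rewrite /momform size_polyXn big_ord_recr/= coefXn eqxx mul1r big1 ?add0r// => i _.
by rewrite coefXn ltn_eqF ?mul0r.
Qed.

Lemma momformX m : momform m 'X = m 1%N. Proof. by rewrite -['X]expr1 momformXn. Qed.

(** A linear relation between values of the functional is tested on monomials. *)
Lemma momform_poly_ind m (T : {poly R} -> {poly R}) r :
  (forall r1 r2, T (r1 + r2) = T r1 + T r2) ->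
  (forall a r1, T (a *: r1) = a *: T r1) ->
  (forall n, momform m (T 'X^n) = 0) -> momform m (T r) = 0.
Proof.
move=> TD TZ TX.
have T0 : T 0 = 0 by have := TZ 0 0; rewrite !scale0r.
rewrite -[r]coefK poly_def.
have : momform m (T (\sum_(i < size r) r`_i *: 'X^i)) = \sum_(i < size r) r`_i * momform m (T 'X^i).
  elim/big_rec2: _ => [|i x y _ <-]; first by rewrite T0 momform0.
  by rewrite TD momformD TZ momformZ.
by move=> ->; apply: big1 => i _; rewrite TX mulr0.
Qed.

End MomentFunctional.

Section EnergyFunctional.
Context {R : realType}.
Implicit Types (r : {poly R}) (z : R).

Definition eform z r : R := momform (mom z) r.

Lemma kern0M n z q : kern n z q = p0 q ^+ n * kern 0 z q :> R.
Proof. by rewrite /kern expr0; ring. Qed.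

Lemma horner_kern r z q : r.[p0 q] * kern 0 z q = \sum_(i < size r) r`_i * kern i z q.
Proof.
rewrite horner_coef mulr_suml; apply: eq_bigr => i _.
by rewrite (kern0M i); ring.
Qed.

Lemma Rintegral_lincomb (D : set R) (g : nat -> R -> R) (c : nat -> R) N :
  measurable D ->
  (forall i, lebesgue_measure.-integrable D (EFin \o g i)) ->
  lebesgue_measure.-integrable D (EFin \o (fun x => \sum_(i < N) c i * g i x)) /\
  \int[lebesgue_measure]_(x in D) (\sum_(i < N) c i * g i x)
   = \sum_(i < N) c i * \int[lebesgue_measure]_(x in D) g i x.
Proof.
move=> mD ig; elim: N => [|N [iN IN]].
  split.
    apply: (@eq_integrable _ _ _ lebesgue_measure _ mD (cst 0%E)).
      by move=> x _; rewrite /= big_ord0.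
    exact: integrable0.
  by rewrite big_ord0 /Rintegral integral0_eq// => x _; rewrite big_ord0.
have icg : lebesgue_measure.-integrable D (EFin \o (fun x => c N * g N x)).
  exact: (@integrableZl _ _ _ lebesgue_measure _ mD (c N) _ (ig N)).
split.
  have := @integrableD _ _ _ lebesgue_measure _ mD _ _ iN icg.
  by apply: eq_integrable => // x _; rewrite /= big_ord_recr.
rewrite big_ord_recr/= -IN -RintegralZl// -RintegralD//.
by apply: eq_Rintegral => x _; rewrite big_ord_recr.
Qed.

Lemma integrable_horner_kern r z : 0 < z ->
  lebesgue_measure.-integrable `[0, +oo[ (EFin \o (fun q => r.[p0 q] * kern 0 z q)).
Proof.
move=> z0; have ik i := integrable_kern i z0.
have [+ _] := Rintegral_lincomb (fun i => r`_i) (size r) (measurable_itv _) ik.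
by apply: eq_integrable => // q _; rewrite /= horner_kern.
Qed.

Lemma integral_horner_kern r z : 0 < z ->
  \int[lebesgue_measure]_(q in `[0, +oo[) (r.[p0 q] * kern 0 z q) = eform z r.
Proof.
move=> z0; have ik i := integrable_kern i z0.
have [_ rE] := Rintegral_lincomb (fun i => r`_i) (size r) (measurable_itv _) ik.
by etransitivity; last exact: rE; apply: eq_Rintegral => q _; rewrite horner_kern.
Qed.

Lemma kern_gt0 k z q : 0 < kern k z q :> R.
Proof. by rewrite divr_gt0 ?mulr_gt0 ?exprn_gt0 ?expR_gt0 ?p0_gt0. Qed.

(** A polynomial nonnegative on [1, oo[ could integrate to 0 only by vanishing
    almost everywhere, hence beyond its Cauchy bound. *)
Lemma eform_gt0 r z : 0 < z -> r != 0 -> (forall x, 1 <= x -> 0 <= r.[x]) ->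
  0 < eform z r.
Proof.
move=> z0 r0 rge0; rewrite -integral_horner_kern//.
have f0 q : 0 <= r.[p0 q] * kern 0 z q.
  by rewrite mulr_ge0 ?kern_ge0// rge0// p0_ge1.
rewrite lt_neqAle Rintegral_ge0 ?andbT//; apply/eqP => /esym I0.
have ir := integrable_horner_kern r z0.
have mr := measurable_int _ ir.
pose f q := r.[p0 q] * kern 0 z q.
have : (\int[lebesgue_measure]_(q in `[0%R, +oo[) `|(f q)%:E| = 0)%E.
  transitivity (\int[lebesgue_measure]_(q in `[0%R, +oo[) (f q)%:E)%E.
    by apply: eq_integral => q _; rewrite gee0_abs ?lee_fin// /f f0.
  rewrite -[LHS]fineK; last exact: (@integrable_fin_num _ _ _ lebesgue_measure _ (measurable_itv _) _ ir).
  by congr EFin; exact: I0.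
move/(ae_eq_integral_abs lebesgue_measure (measurable_itv _) mr).
rewrite /ae_eq => -[N [mN N0 subN]].
pose B := cauchy_bound r.
have B0 : 0 <= B by rewrite ltW// cauchy_bound_gt0.
have sBN : `]B, (B + 1)[%classic `<=` N.
  move=> q; rewrite /= in_itv/= => /andP[Bq _]; apply: subN => /=.
  have q0 : 0 <= q by exact: le_trans B0 (ltW Bq).
  move=> /(_ _); rewrite in_itv/= q0 => /(_ isT) [].
  move/eqP; rewrite mulf_eq0 (gt_eqF (kern_gt0 _ _ _)) orbF => /eqP rq.
  have := cauchy_boundP r0 rq.
  rewrite ger0_norm ?(ltW (p0_gt0 _))// ltNge => /negP; apply.
  by apply: le_trans (ltW Bq) _; apply: le_trans (ler_norm _) (p0_ge_norm _).
have : (lebesgue_measure `]B, (B + 1)%R[%classic <= lebesgue_measure N)%E.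
  by apply: le_measure; rewrite ?inE.
rewrite N0 lebesgue_measure_itv/= lte_fin ltrDl ltr01 -EFinD lee_fin; lra.
Qed.

Lemma eformD z r s : eform z (r + s) = eform z r + eform z s. Proof. exact: momformD. Qed.
Lemma eformB z r s : eform z (r - s) = eform z r - eform z s. Proof. exact: momformB. Qed.
Lemma eformZ z a r : eform z (a *: r) = a * eform z r. Proof. exact: momformZ. Qed.
Lemma eform_sum z I (t : seq I) (Q : pred I) (F : I -> {poly R}) :
  eform z (\sum_(i <- t | Q i) F i) = \sum_(i <- t | Q i) eform z (F i).
Proof. exact: momform_sum. Qed.
Lemma eformXn z n : eform z 'X^n = mom z n. Proof. exact: momformXn. Qed.
Lemma eformX z : eform z 'X = mom z 1. Proof. exact: momformX. Qed.

Lemma mom_gt0 z k : 0 < z -> 0 < mom z k.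
Proof.
move=> z0; rewrite -eformXn; apply: eform_gt0 => //; first by rewrite -size_poly_gt0 size_polyXn.
by move=> x x1; rewrite hornerXn exprn_ge0// (le_trans ler01).
Qed.

(** The left-hand side integrates the derivative of
    [q * r.[p0 q] * expR (- z * p0 q)]. For [r = 1] this is [mom_by_parts];
    differentiating in [z] multiplies [r] by the variable up to sign, and so
    gives all monomials. *)
Lemma eform_by_parts z r : 0 < z ->
  eform z (('X^2 - 1) * (r^`() - z *: r) + 'X * r) = 0.
Proof.
move=> z0.
apply: (@momform_poly_ind _ (mom z) (fun r => ('X^2 - 1) * (r^`() - z *: r) + 'X * r)).
- by move=> r1 r2; rewrite derivD scalerDr; ring.
- move=> a r1; rewrite derivZ -!mul_polyC; ring.
move=> n; rewrite -/(eform z _).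
pose u n y : R := n.+1%:R * mom y n.+1 - n%:R * mom y n.-1 - y * (mom y n.+2 - mom y n).
have uE : eform z (('X^2 - 1) * (('X^n)^`() - z *: 'X^n) + 'X * 'X^n) = u n z.
  rewrite derivXn.
  case: n => [|n].
    rewrite mulr0n sub0r expr0 mulr1 /u.
    have -> : ('X^2 - 1) * - (z *: 1) + 'X = 'X - z *: ('X^2 - 1) :> {poly R}.
      by rewrite -!mul_polyC; ring.
    rewrite eformB eformX eformZ eformB -(expr0 'X) !eformXn; ring.
  have -> : ('X^2 - 1) * ('X^(n.+1.-1) *+ n.+1 - z *: 'X^(n.+1)) + 'X * 'X^(n.+1)
    = n.+2%:R *: 'X^(n.+2) - n.+1%:R *: 'X^n - z *: ('X^(n.+3) - 'X^(n.+1)) :> {poly R}.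
    rewrite -!mul_polyC -mulr_natl !polyC_natr !exprS /=; ring.
  by rewrite !eformB !eformZ !eformB !eformXn.
rewrite uE.
have {uE}u0 : forall k y, 0 < y -> u k y = 0.
  elim=> [|k IH] y y0.
    by rewrite /u mul0r mul1r (mom_by_parts y0); ring.
  have d1 j := is_derive_mom j y0.
  have du : is_derive y 1 (u k) (- u k.+1 y).
    rewrite /u; apply: is_derive_eq.
    rewrite /GRing.scale/=.
    case: k {IH} => [|k] /=; rewrite -!natr1; ring.
  have dz : is_derive y 1 (u k) 0.
    apply: (@near_eq_is_derive _ _ _ (fun=> 0)).
    by near=> x; rewrite IH//; near: x; exact: lt_nbhsr.
  have [_ h1] := du; have [_ h2] := dz; move: h1; rewrite h2 => /eqP.
  by rewrite eq_sym oppr_eq0 => /eqP.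
exact: u0.
Unshelve. all: by end_near. Qed.

End EnergyFunctional.

(** * The Bessel normalisation *)

Section Bessel.
Context {R : realType}.
Implicit Types q z : R.

Lemma cvg_p0V : (p0 q)^-1 @[q --> +oo] --> (0 : R).
Proof.
apply: (@squeeze_cvgr _ _ _ _ (fun=> 0) (fun q => q^-1)).
- near=> q; have q0 : 0 < q by near: q; exact: nbhs_pinfty_gt.
  rewrite invr_ge0 ltW ?p0_gt0//= lef_pV2 ?posrE ?p0_gt0//.
  by rewrite (le_trans (ler_norm _))// p0_ge_norm.
- exact: cvg_cst.
- apply/gtr0_cvgV0; first by near=> q; near: q; exact: nbhs_pinfty_gt.
  exact: cvg_id.
Unshelve. all: by end_near. Qed.

Lemma addr_p0_gt0 q : 0 < q + p0 q.
Proof.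
have h1 := sqr_p0 q; have h2 := p0_ge_norm q; have h3 := p0_gt0 q.
have h4 : - q <= p0 q by rewrite (le_trans _ h2)// ler_normr lexx orbT.
rewrite lt_neqAle; apply/andP; split; last lra.
apply/eqP => h; have E : p0 q = - q by lra.
by move: h1; rewrite E; nra.
Qed.

Definition arsinh q := ln (q + p0 q).

Lemma expR_arsinh q : expR (arsinh q) = q + p0 q.
Proof. by rewrite lnK// posrE addr_p0_gt0. Qed.

Lemma expR_arsinhN q : expR (- arsinh q) = p0 q - q.
Proof.
rewrite expRN expR_arsinh; have := addr_p0_gt0 q => h.
apply: (mulIf (lt0r_neq0 h)); rewrite mulVf ?gt_eqF//.
by have := sqr_p0 q; lra.
Qed.

Lemma is_derive_arsinh q : is_derive q 1 arsinh (p0 q)^-1.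
Proof.
have h := addr_p0_gt0 q.
have dl := is_derive1_ln h.
have ds : is_derive q 1 (fun x : R => x + p0 x) (1 + q / p0 q) by apply: is_derive_eq.
have dc := @is_derive1_comp R (@ln R) (fun x : R => x + p0 x) q _ _ dl ds.
suff <- : (q + p0 q)^-1 * (1 + q / p0 q) = (p0 q)^-1 by exact: dc.
by field; rewrite p0_neq0 gt_eqF.
Qed.

Lemma cvg_arsinh : arsinh q @[q --> +oo] --> +oo.
Proof.
apply/cvgryPge => A; near=> q.
have q0 : expR A <= q by near: q; apply: nbhs_pinfty_ge; rewrite num_real.
rewrite -ler_expR expR_arsinh (le_trans q0)// lerDl.
exact/ltW/p0_gt0.
Unshelve. all: by end_near. Qed.

Lemma derive1_arsinh : arsinh^`()%classic = (fun q => (p0 q)^-1).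
Proof. by apply/funext => q; rewrite derive1E; apply: derive_val; exact: is_derive_arsinh. Qed.

Lemma continuous_p0V : continuous (fun q : R => (p0 q)^-1).
Proof. by move=> q; apply: cvgV; [exact: p0_neq0|exact: continuous_p0]. Qed.

Lemma homo_arsinh : {homo arsinh : x y / x < y}.
Proof.
move=> x y xy; rewrite -ltr_expR !expR_arsinh.
have h := sqr_p0 x; have h' := sqr_p0 y.
have hx := addr_p0_gt0 x; have hy := addr_p0_gt0 y.
have a1 := p0_gt0 x; have a2 := p0_gt0 y.
have E : (y + p0 y - (x + p0 x)) * (p0 x + p0 y) = (y - x) * (p0 x + p0 y + x + y).
  have -> : (y + p0 y - (x + p0 x)) * (p0 x + p0 y)
    = (y - x) * (p0 x + p0 y) + (p0 y ^+ 2 - p0 x ^+ 2) by ring.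
  by rewrite h h'; ring.
rewrite -subr_gt0 -(pmulr_lgt0 _ (addr_gt0 a1 a2)) E mulr_gt0//; lra.
Qed.

(** Under [t = arsinh q], [cosh t] is [p0 q] and dt is dq / p0 q. *)
Lemma besselK1_mom z : besselK 1 z = mom z 1.
Proof.
pose G t : R := (expR (1 * t) + expR (- (1 * t))) / 2
      * expR (- z * ((expR t + expR (- t)) / 2)).
rewrite /besselK /mom /Rintegral; congr fine.
have c0 : continuous (fun t : R => (expR t + expR (- t)) / 2).
  move=> t; apply: cvgM; last exact: cvg_cst.
  apply: cvgD; first exact: continuous_expR.
  apply: (@continuous_comp _ _ _ (@GRing.opp R) expR); last exact: continuous_expR.
  exact: (@continuousN _ R^o).
have cG : continuous G.
  move=> t; rewrite /G; apply: cvgM.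
    under eq_fun do rewrite mul1r; rewrite mul1r; exact: c0.
  apply: (@continuous_comp _ _ _ (fun t => - z * ((expR t + expR (- t)) / 2)) expR).
    by apply: cvgM; [exact: cvg_cst|exact: c0].
  exact: continuous_expR.
have T0 : arsinh 0 = 0 by rewrite /arsinh /p0 expr0n/= addr0 sqrtr1 add0r ln1.
have := @increasing_ge0_integration_by_substitutiony _ arsinh G 0.
rewrite T0 => H; transitivity
  (\int[lebesgue_measure]_(x in `[0%R, +oo[) (((G \o arsinh) * arsinh^`()%classic) x)%:E)%E.
  apply: H.
  - by move=> x y _ _; exact: homo_arsinh.
  - by move=> x _; rewrite derive1_arsinh; exact: continuous_p0V.
  - rewrite derive1_arsinh; apply/cvg_ex; exists (p0 0)^-1.
    by apply: cvg_at_right_filter; exact: continuous_p0V.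
  - by rewrite derive1_arsinh; apply/cvg_ex; exists 0; exact: cvg_p0V.
  - split; first by move=> x _; have [] := is_derive_arsinh x.
    apply: cvg_at_right_filter; apply: differentiable_continuous.
    by apply/derivable1_diffP; have [] := is_derive_arsinh 0.
  - exact: cvg_arsinh.
  - exact: continuous_subspaceT.
  - by move=> t _; rewrite /G mulr_ge0 ?expR_ge0// divr_ge0 ?addr_ge0 ?expR_ge0.
apply: eq_integral => q _; congr EFin; rewrite derive1_arsinh.
transitivity (G (arsinh q) * (p0 q)^-1); first by [].
rewrite /G !mul1r expR_arsinh expR_arsinhN.
have -> : (q + p0 q + (p0 q - q)) / 2 = p0 q by field.
by rewrite /kern expr1.
Qed.

End Bessel.

(** * The weighted inner products in the energy variable *)

Section EnergyIntegral.
Context {R : realType}.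
Implicit Types q z x : R.

Definition invroot x : R := (x ^+ 2 - 1) `^ (- 2^-1).

Lemma invroot_p0 q : 0 < q -> invroot (p0 q) = q^-1.
Proof.
move=> q0; rewrite /invroot sqr_p0 addrAC subrr add0r powRN.
by rewrite powR12_sqrt ?sqr_ge0// sqrtr_sqr gtr0_norm.
Qed.

Lemma invroot_ge0 x : 0 <= invroot x. Proof. exact: powR_ge0. Qed.

Lemma derive1_p0 : (@p0 R)^`()%classic = (fun q => q / p0 q).
Proof. by apply/funext => q; rewrite derive1E; apply: derive_val; exact: is_derive_p0. Qed.

Lemma continuous_derive_p0 : continuous (fun q : R => q / p0 q).
Proof. by move=> q; apply: cvgM; [exact: cvg_id|exact: continuous_p0V]. Qed.

Lemma cvg_derive_p0 : q / p0 q @[q --> +oo] --> (1 : R).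
Proof.
apply: (@squeeze_cvgr _ _ _ _ (fun q => 1 - (p0 q)^-1) (fun=> 1)).
- near=> q; have q0 : 0 < q by near: q; exact: nbhs_pinfty_gt.
  have h := p0_gt0 q; have h1 := sqr_p0 q; have h2 := p0_ge_norm q.
  have h3 : q <= p0 q by rewrite (le_trans (ler_norm _)).
  rewrite ler_pdivrMr// mul1r h3 andbT ler_pdivlMr// mulrBl mul1r mulVf ?gt_eqF//; nra.
- rewrite -[X in _ --> X]subr0; apply: cvgB; [exact: cvg_cst|exact: cvg_p0V].
- exact: cvg_cst.
Unshelve. all: by end_near. Qed.

Lemma cvg_p0y : p0 q @[q --> +oo] --> (+oo : set_system R).
Proof.
apply/cvgryPge => A; near=> q.
have qA : A <= q by near: q; apply: nbhs_pinfty_ge; rewrite num_real.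
by rewrite (le_trans qA)// (le_trans (ler_norm _))// p0_ge_norm.
Unshelve. all: by end_near. Qed.

Lemma homo_p0 x y : 0 <= x -> x < y -> p0 x < p0 y.
Proof.
move=> x0 xy; have y0 := le_lt_trans x0 xy.
rewrite /p0 ltr_sqrt ?ltrD2l ?ltr_pXn2r ?nnegrE ?(ltW y0)//.
by rewrite ltr_wpDr// sqr_ge0.
Qed.

Definition xkern n z x := x ^+ n * invroot x * expR (- z * x).

Lemma xkern_ge0 n z x : 0 <= x -> 0 <= xkern n z x.
Proof. by move=> x0; rewrite !mulr_ge0 ?exprn_ge0 ?invroot_ge0 ?expR_ge0. Qed.

Lemma continuous_xkern n z x : 1 < x -> {for x, continuous (xkern n z)}.
Proof.
move=> x1; rewrite /xkern; apply: cvgM; last exact: continuous_expRNM.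
apply: cvgM; first exact: exprn_continuous.
apply: (@continuous_comp _ _ _ (fun x => x ^+ 2 - 1) (fun y => y `^ (- 2^-1))).
  by apply: cvgB; [exact: exprn_continuous|exact: cvg_cst].
apply: differentiable_continuous; apply/derivable1_diffP.
by apply: derivable_powR; rewrite in_itv/= andbT subr_gt0 -[ltLHS](expr1n _ 2) ltr_pXn2r ?nnegrE// (le_trans ler01 (ltW x1)).
Qed.

Lemma xkern_p0 n z q : 0 < q -> xkern n z (p0 q) * (q / p0 q) = kern n z q.
Proof.
move=> q0; rewrite /xkern invroot_p0// /kern; field.
by rewrite p0_neq0 gt_eqF.
Qed.

Lemma p0_gt1 q : 0 < q -> 1 < p0 q.
Proof. by move=> q0; rewrite -[ltLHS]sqrtr1 ltr_sqrt ?ltrDl ?exprn_gt0// ltr_pwDl// sqr_ge0. Qed.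

Lemma integral_xkern_from n z q : 0 < q ->
  (\int[lebesgue_measure]_(x in `[p0 q, +oo[) (xkern n z x)%:E =
   \int[lebesgue_measure]_(s in `[q, +oo[) (kern n z s)%:E)%E.
Proof.
move=> q0.
transitivity (\int[lebesgue_measure]_(x in `[q, +oo[)
   (((xkern n z \o @p0 R) * (@p0 R)^`()%classic) x)%:E)%E.
  apply: increasing_ge0_integration_by_substitutiony.
  - move=> x y; rewrite !in_itv/= !andbT => qx _; apply: homo_p0.
    exact: le_trans (ltW q0) qx.
  - by move=> x _; rewrite derive1_p0; exact: continuous_derive_p0.
  - rewrite derive1_p0; apply/cvg_ex; exists (q / p0 q).
    by apply: cvg_at_right_filter; exact: continuous_derive_p0.
  - by rewrite derive1_p0; apply/cvg_ex; exists 1; exact: cvg_derive_p0.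
  - split; first by move=> x _; have [] := is_derive_p0 x.
    by apply: cvg_at_right_filter; exact: continuous_p0.
  - exact: cvg_p0y.
  - apply/continuous_within_itvcyP; split.
      move=> x; rewrite in_itv/= andbT => qx; apply: continuous_xkern.
      exact: lt_trans (p0_gt1 q0) qx.
    by apply: cvg_at_right_filter; apply: continuous_xkern; exact: p0_gt1.
  - move=> x; rewrite in_itv/= andbT => qx; apply: xkern_ge0.
    by rewrite ltW// (lt_trans _ qx)// p0_gt0.
apply: eq_integral => s; rewrite inE/= in_itv/= andbT => qs.
rewrite derive1_p0; congr EFin.
transitivity (xkern n z (p0 s) * (s / p0 s)); first by [].
by rewrite xkern_p0// (lt_le_trans q0).
Qed.

Lemma bigcup_itvcy (a : nat -> R) (b : R) :
  (forall k, b < a k) -> (forall x, b < x -> exists k, a k <= x) ->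
  \bigcup_k `[a k, +oo[%classic = `]b, +oo[%classic.
Proof.
move=> ba ha; apply/seteqP; split => x /=.
  by move=> [k _]; rewrite /= !in_itv/= !andbT; exact: lt_le_trans.
rewrite in_itv/= andbT => bx; have [k ak] := ha x bx.
by exists k => //; rewrite /= in_itv/= ak.
Qed.

Lemma measurable_xkern n z : measurable_fun `](1 : R), +oo[ (xkern n z).
Proof.
apply: open_continuous_measurable_fun => // x; rewrite inE/= in_itv/= andbT => x1.
exact: continuous_xkern.
Qed.

(** The weight is singular at 1, so the substitution [x = p0 q] is made on
    half-lines [ [p0 q, oo[ ] and [q] is sent to 0 by monotone convergence. *)
Lemma integral_xkern n z : 0 < z ->
  (\int[lebesgue_measure]_(x in `[1%R, +oo[) (xkern n z x)%:E = (mom z n)%:E)%E.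
Proof.
move=> z0.
pose a (k : nat) : R := k.+1%:R^-1.
have a0 k : 0 < a k by rewrite invr_gt0.
have a_ge x : 0 < x -> exists k, a k <= x.
  move=> x0; exists (Num.truncn x^-1); rewrite /a -[leRHS]invrK.
  rewrite lef_pV2 ?posrE ?invr_gt0//; apply/ltW/truncnS_gt.
have nd k j : (k <= j)%N -> a j <= a k.
  by move=> kj; rewrite lef_pV2 ?posrE// ler_nat ltnS.
have p0_le x y : 0 <= x -> x <= y -> p0 x <= p0 y.
  move=> x0; rewrite le_eqVlt => /predU1P[->//|xy]; exact/ltW/homo_p0.
have E1 : \bigcup_k `[p0 (a k), +oo[%classic = `]1, +oo[%classic.
  apply: bigcup_itvcy => [k|x x1]; first exact: p0_gt1.
  have h : 0 < Num.sqrt (x ^+ 2 - 1).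
    by rewrite sqrtr_gt0 subr_gt0 -[ltLHS](expr1n _ 2) ltr_pXn2r ?nnegrE// (le_trans ler01 (ltW x1)).
  have [k ak] := a_ge _ h; exists k.
  apply: le_trans (p0_le _ _ (ltW (a0 k)) ak) _.
  rewrite /p0 sqr_sqrtr; last by move: h; rewrite sqrtr_gt0 => /ltW.
  by rewrite addrC subrK sqrtr_sqr gtr0_norm// (lt_trans ltr01).
have E0 : \bigcup_k `[a k, +oo[%classic = `]0, +oo[%classic.
  by apply: bigcup_itvcy => // x x0; apply: a_ge.
have mk : measurable_fun `](0 : R), +oo[ (EFin \o kern n z).
  by apply/measurable_EFinP; exact: measurable_kern.
have mx : measurable_fun `](1 : R), +oo[ (EFin \o xkern n z).
  by apply/measurable_EFinP; exact: measurable_xkern.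
rewrite -integral_itv_obnd_cbnd; last exact: mx.
have -> : (mom z n)%:E = (\int[lebesgue_measure]_(x in `]0%R, +oo[) (kern n z x)%:E)%E.
  rewrite integral_itv_obnd_cbnd; last exact: mk.
  rewrite /mom /Rintegral fineK//.
  exact: (@integrable_fin_num _ _ _ lebesgue_measure _ (measurable_itv _) _ (integrable_kern n z0)).
rewrite -E1 -E0.
have C1 : (\int[lebesgue_measure]_(x in `[p0 (a k), +oo[) (xkern n z x)%:E @[k --> \oo] -->
   \int[lebesgue_measure]_(x in \bigcup_k `[p0 (a k), +oo[%classic) (xkern n z x)%:E)%E.
  apply: ge0_nondecreasing_set_cvg_integral => //.
  - apply/nondecreasing_seqP => k; rewrite subsetEset => x /=.
    rewrite !in_itv/= !andbT; apply: le_trans; apply: p0_le; first exact: ltW.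
    exact: nd.
  - move=> k; apply: measurable_funS mx => //.
    by move=> x; rewrite /= !in_itv/= !andbT; apply: lt_le_trans; exact: p0_gt1.
  - move=> k x; rewrite /= in_itv/= andbT => h; rewrite lee_fin xkern_ge0//.
    by rewrite (le_trans _ h)// ltW// p0_gt0.
have C0 : (\int[lebesgue_measure]_(x in `[a k, +oo[) (kern n z x)%:E @[k --> \oo] -->
   \int[lebesgue_measure]_(x in \bigcup_k `[a k, +oo[%classic) (kern n z x)%:E)%E.
  apply: ge0_nondecreasing_set_cvg_integral => //.
  - apply/nondecreasing_seqP => k; rewrite subsetEset => x /=.
    by rewrite !in_itv/= !andbT; apply: le_trans; exact: nd.
  - move=> k; apply: measurable_funS mk => //.
    by move=> x; rewrite /= !in_itv/= !andbT; exact: lt_le_trans.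
  - by move=> k x _; rewrite lee_fin kern_ge0.
have C10 : (fun k => \int[lebesgue_measure]_(x in `[p0 (a k), +oo[) (xkern n z x)%:E)%E
  = (fun k => \int[lebesgue_measure]_(x in `[a k, +oo[) (kern n z x)%:E)%E.
  by apply/funext => k; exact: integral_xkern_from.
rewrite C10 in C1.
by apply: cvg_unique C1 C0.
Qed.

Lemma integrable_xkern n z : 0 < z ->
  lebesgue_measure.-integrable `[1, +oo[ (EFin \o xkern n z).
Proof.
move=> z0; apply/integrableP; split.
  apply/measurable_EFinP/measurable_fun_itv_obnd_cbndP.
  exact: measurable_xkern.
rewrite (_ : (\int[_]_(_ in _) _)%E = (mom z n)%:E) ?ltry//.
rewrite -integral_xkern//; apply: eq_integral => x; rewrite inE/= in_itv/= andbT => x1.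
by rewrite /= ger0_norm// xkern_ge0// (le_trans ler01 x1).
Qed.

Lemma integral_horner_invroot (r : {poly R}) z : 0 < z ->
  lebesgue_measure.-integrable `[1, +oo[
    (EFin \o (fun x => r.[x] * invroot x * expR (- z * x))) /\
  \int[lebesgue_measure]_(x in `[1, +oo[) (r.[x] * invroot x * expR (- z * x))
    = eform z r.
Proof.
move=> z0; have ix i := integrable_xkern i z0.
have [i1 i2] := Rintegral_lincomb (fun i => r`_i) (size r) (measurable_itv _) ix.
have E x : r.[x] * invroot x * expR (- z * x) = \sum_(i < size r) r`_i * xkern i z x.
  by rewrite horner_coef !mulr_suml; apply: eq_bigr => i _; rewrite /xkern; ring.
split; first by apply: eq_integrable i1 => // x _; rewrite /= E.
transitivity (\sum_(i < size r) r`_i * \int[lebesgue_measure]_(x in `[1, +oo[) xkern i z x).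
  by rewrite -i2; apply: eq_Rintegral => x _; rewrite E.
by apply: eq_bigr => i _; rewrite /Rintegral integral_xkern.
Qed.

(** The quotient of the weight of superscript [l] by that of superscript 0. *)
Definition wgt (l : bool) : {poly R} := if l then 'X^2 - 1 else 1.

Lemma innerw_eform l z (r s : {poly R}) : 0 < z ->
  innerw l z (horner r) (horner s) = (mom z 1)^-1 * eform z (wgt l * (r * s)).
Proof.
move=> z0; have [i1 <-] := integral_horner_invroot (wgt l * (r * s)) z0.
rewrite -RintegralZl//; apply: eq_Rintegral => x; rewrite inE/= in_itv/= andbT => x1.
rewrite /omega besselK1_mom !hornerM.
suff -> : (x ^+ 2 - 1) `^ (l%:R - 2^-1) = (wgt l).[x] * invroot x by ring.
case: l {i1}; rewrite /wgt/=; last by rewrite hornerC mul1r sub0r.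
rewrite !hornerE /invroot.
have x21 : 0 <= x ^+ 2 - 1 by rewrite subr_ge0 -[leLHS](expr1n _ 2) lerXn2r ?nnegrE// (le_trans ler01).
have [->|n0] := eqVneq (x ^+ 2 - 1) 0.
  rewrite mul0r powR0//; have -> : 1 - 2^-1 = 2^-1 :> R by field.
  by rewrite invr_eq0.
by rewrite -[X in X * _]powRr1// -powRD// n0 implybT.
Qed.

End EnergyIntegral.

(** * Boosts and the inner product on momenta *)

Section Boost.
Context {R : realType}.
Variable u : R.
Hypothesis u1 : `|u| < 1.
Implicit Types p s q : R.

Let u2 : 0 < 1 - u ^+ 2.
Proof. by rewrite subr_gt0 -real_normK ?num_real// expr_lt1 ?normr_ge0. Qed.

Lemma U0_gt0 : 0 < U0 u. Proof. by rewrite invr_gt0 sqrtr_gt0. Qed.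

Lemma U0_sqr : U0 u ^+ 2 = (1 - u ^+ 2)^-1.
Proof. by rewrite /U0 exprVn sqr_sqrtr// ltW. Qed.

Lemma U0_U1 : U0 u ^+ 2 - U1 u ^+ 2 = 1.
Proof.
have -> : U0 u ^+ 2 - U1 u ^+ 2 = U0 u ^+ 2 * (1 - u ^+ 2) by rewrite /U1; ring.
by rewrite U0_sqr mulVf// gt_eqF.
Qed.

(** Up to sign, the spatial momentum in the comoving frame; [EE u] is the energy
    there. *)
Definition QQ p := U1 u * p0 p - U0 u * p.

Lemma pperpE p : pperp u p / U0 u = QQ p.
Proof.
have h := U0_U1; have hn : U0 u != 0 by rewrite gt_eqF// U0_gt0.
apply: (mulIf hn); rewrite divfK// /pperp /EE /QQ.
have -> : - p = - p * (U0 u ^+ 2 - U1 u ^+ 2) by rewrite h mulr1.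
ring.
Qed.

Lemma EE_QQ p : EE u p ^+ 2 = 1 + QQ p ^+ 2.
Proof.
have h := U0_U1; have h2 := sqr_p0 p.
have -> : EE u p ^+ 2 = (U0 u ^+ 2 - U1 u ^+ 2) * (p0 p ^+ 2 - p ^+ 2) + QQ p ^+ 2.
  by rewrite /EE /QQ; ring.
by rewrite h h2; ring.
Qed.

Lemma U1_lt : `|U1 u| < U0 u.
Proof. by rewrite /U1 normrM (gtr0_norm U0_gt0) gtr_pMl// U0_gt0. Qed.

(** The inverse of [- QQ]. *)
Definition boost s := U1 u * p0 s + U0 u * s.

Lemma p0_boost s : p0 (boost s) = U0 u * p0 s + U1 u * s.
Proof.
have h := U0_U1; have h2 := sqr_p0 s.
have E : 1 + boost s ^+ 2 = (U0 u * p0 s + U1 u * s) ^+ 2.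
  have -> : 1 + boost s ^+ 2 = (U0 u * p0 s + U1 u * s) ^+ 2
     + (1 - (U0 u ^+ 2 - U1 u ^+ 2) * (p0 s ^+ 2 - s ^+ 2)) by rewrite /boost; ring.
  by rewrite h h2; ring.
rewrite /p0 E sqrtr_sqr -/(p0 s) gtr0_norm//.
have h3 := U1_lt; have h4 := p0_ge_norm s; have h5 := p0_gt0 s.
have h6 : - (`|U1 u| * `|s|) <= U1 u * s by rewrite -normrM; apply: lerNnormlW.
apply: lt_le_trans (_ : U0 u * p0 s - `|U1 u| * `|s| <= _); last by rewrite lerD2l.
rewrite subr_gt0; apply: le_lt_trans (_ : `|U1 u| * p0 s < _); first by rewrite ler_wpM2l.
by rewrite ltr_pM2r.
Qed.

Lemma EE_boost s : EE u (boost s) = p0 s.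
Proof.
rewrite /EE p0_boost /boost.
transitivity ((U0 u ^+ 2 - U1 u ^+ 2) * p0 s); first by ring.
by rewrite U0_U1 mul1r.
Qed.

Lemma QQ_boost s : QQ (boost s) = - s.
Proof.
rewrite /QQ p0_boost /boost.
transitivity (- ((U0 u ^+ 2 - U1 u ^+ 2) * s)); first by ring.
by rewrite U0_U1 mul1r.
Qed.

Lemma is_derive_boost s : is_derive s 1 boost (p0 (boost s) / p0 s).
Proof.
rewrite p0_boost; have h := p0_neq0 s.
apply: is_derive_eq; rewrite /GRing.scale/=; field; exact: h.
Qed.

Lemma derive1_boost : boost^`()%classic = (fun s => U0 u + U1 u * (s / p0 s)).
Proof.
apply/funext => s; rewrite derive1E.
rewrite (_ : 'D_1 boost s = p0 (boost s) / p0 s); last by apply: derive_val; exact: is_derive_boost.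
by rewrite p0_boost; field; exact: p0_neq0.
Qed.

Lemma continuous_boost : continuous boost.
Proof.
by move=> s; apply: differentiable_continuous; apply/derivable1_diffP; have [] := is_derive_boost s.
Qed.

Lemma homo_boost : {homo boost : x y / x < y}.
Proof.
move=> x y xy.
have [c _ h] := @MVT _ boost (fun c => p0 (boost c) / p0 c) _ _ xy
  (fun c _ => is_derive_boost c) (continuous_subspaceT continuous_boost).
by rewrite -subr_gt0 h mulr_gt0 ?divr_gt0 ?p0_gt0// subr_gt0.
Qed.

Lemma le_boost s : 0 <= s -> (U0 u - `|U1 u|) * s - `|U1 u| <= boost s.
Proof.
move=> s0; have h3 := U1_lt.
have h4 : p0 s <= 1 + s.
  rewrite -(@ler_pXn2r _ 2)// ?nnegrE ?addr_ge0 ?(ltW (p0_gt0 s))// sqr_p0; nra.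
have h5 := ler_norm (- U1 u); rewrite normrN in h5.
have h6 : - (`|U1 u| * p0 s) <= U1 u * p0 s.
  by rewrite -mulNr ler_wpM2r ?(ltW (p0_gt0 s))//; lra.
have h7 : `|U1 u| * p0 s <= `|U1 u| * (1 + s) by rewrite ler_wpM2l.
rewrite /boost; lra.
Qed.
End Boost.

Section InnerProduct.
Context {R : realType}.
Implicit Types u p s q z : R.

Lemma U1N u : U1 (- u) = - U1 u. Proof. by rewrite /U1 /U0 sqrrN mulNr. Qed.
Lemma U0N u : U0 (- u) = U0 u. Proof. by rewrite /U0 sqrrN. Qed.
Lemma boostN u s : boost (- u) (- s) = - boost u s.
Proof. by rewrite /boost U1N U0N p0N; ring. Qed.

Lemma cvg_boosty u : `|u| < 1 -> boost u s @[s --> +oo] --> (+oo : set_system R).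
Proof.
move=> u1; have h := U1_lt u1; rewrite -subr_gt0 in h.
apply/cvgryPge => A; near=> s.
have s0 : 0 <= s by near: s; apply: nbhs_pinfty_ge; rewrite num_real.
have sA : (A + `|U1 u|) / (U0 u - `|U1 u|) <= s.
  by near: s; apply: nbhs_pinfty_ge; rewrite num_real.
apply: le_trans (le_boost u1 s0).
rewrite ler_pdivrMr// in sA; lra.
Unshelve. all: by end_near. Qed.

Lemma cvg_boostNy u : `|u| < 1 -> boost u s @[s --> -oo] --> (-oo : set_system R).
Proof.
move=> u1; have Nu1 : `|- u| < 1 by rewrite normrN.
apply/cvgNy_compNP.
have -> : (fun s => boost u s) \o -%R = (fun s => - (boost (- u) s)).
  by apply/funext => s /=; rewrite -[in RHS](opprK s) boostN opprK.
by apply/cvgNrNy; exact: cvg_boosty.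
Qed.

Lemma cvg_derive_p0Ny : q / p0 q @[q --> -oo] --> (- 1 : R).
Proof.
apply/cvgNy_compNP.
rewrite (_ : _ \o _ = fun q : R => - (q / p0 q)); first by apply: cvgN; exact: cvg_derive_p0.
by apply/funext => q /=; rewrite p0N mulNr.
Qed.

(** The measure dp / p0 p is invariant under boosts. *)
Lemma integral_boost u (G : R -> R) : `|u| < 1 -> continuous G -> (forall p, 0 <= G p) ->
  (\int[lebesgue_measure]_p (G p)%:E =
   \int[lebesgue_measure]_s (G (boost u s) * (p0 (boost u s) / p0 s))%:E)%E.
Proof.
move=> u1 cG G0.
transitivity (\int[lebesgue_measure]_s (((G \o boost u) * (boost u)^`()%classic) s)%:E)%E.
  apply: increasing_ge0_integration_by_substitutionT => //.
  - exact: homo_boost.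
  - rewrite derive1_boost// => s; apply: cvgD; first exact: cvg_cst.
    by apply: cvgM; [exact: cvg_cst|exact: continuous_derive_p0].
  - rewrite derive1_boost//; apply/cvg_ex; exists (U0 u + U1 u * - 1).
    by apply: cvgD; [exact: cvg_cst|apply: cvgM; [exact: cvg_cst|exact: cvg_derive_p0Ny]].
  - rewrite derive1_boost//; apply/cvg_ex; exists (U0 u + U1 u * 1).
    by apply: cvgD; [exact: cvg_cst|apply: cvgM; [exact: cvg_cst|exact: cvg_derive_p0]].
  - exact: cvg_boostNy.
  - exact: cvg_boosty.
apply: eq_integral => s _; congr EFin; rewrite derive1_boost//.
transitivity (G (boost u s) * (U0 u + U1 u * (s / p0 s))); first by [].
by congr *%R; rewrite p0_boost//; field; exact: p0_neq0.
Qed.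

Lemma integral_symm (G : R -> R) : continuous G -> (forall p, 0 <= G p) ->
  (\int[lebesgue_measure]_p (G p)%:E =
   \int[lebesgue_measure]_(s in `[0%R, +oo[) (G s + G (- s))%:E)%E.
Proof.
move=> cG G0.
have mG (D : set R) : measurable_fun D (EFin \o G).
  by apply/measurable_EFinP/measurable_funTS; exact: continuous_measurable_fun.
have cGN : continuous (G \o -%R).
  by move=> s; apply: (@continuous_comp _ _ _ (@GRing.opp R) G); [exact: (@continuousN _ R^o)|exact: cG].
have mGN (D : set R) : measurable_fun D (EFin \o (G \o -%R)).
  by apply/measurable_EFinP/measurable_funTS; exact: continuous_measurable_fun.
have HN : (\int[lebesgue_measure]_(p in `]-oo, 0%R]) (G p)%:E =
    \int[lebesgue_measure]_(s in `[0%R, +oo[) (G (- s))%:E)%E.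
  have := @ge0_integration_by_substitutionNy R G 0; rewrite oppr0; apply.
  - exact: continuous_subspaceT.
  - by move=> x _; exact: G0.
rewrite -(setUv (`[0%R, +oo[%classic : set R)) ge0_integral_setU//=; last 3 first.
- exact: mG.
- by move=> x _; rewrite lee_fin.
- exact/disj_setPCl.
rewrite setCitvr.
rewrite integral_itv_bndo_bndc; last exact: mG.
rewrite [X in (_ + X)%E]HN -ge0_integralD//=.
- by move=> x _; rewrite lee_fin.
- exact: mG.
- by move=> x _; rewrite lee_fin.
- exact: mGN.
- exact: measurableC.
Qed.



(** The two families of integrands to which the inner product on momenta
    reduces; the second one is odd in [QQ], hence not of constant sign. *)
Definition ekern u n z p := EE u p ^+ n * expR (- z * EE u p) / p0 p.
Definition okern u n z p := QQ u p * ekern u n z p.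

Lemma EE_gt0 u p : `|u| < 1 -> 0 < EE u p.
Proof.
move=> u1; have h := U1_lt u1; have h1 := p0_ge_norm p; have h2 := p0_gt0 p.
rewrite /EE subr_gt0; apply: le_lt_trans (ler_norm _) _; rewrite normrM.
by apply: le_lt_trans (ler_wpM2l (normr_ge0 _) h1) _; rewrite ltr_pM2r.
Qed.

Lemma QQ_ge u p : `|u| < 1 -> - EE u p <= QQ u p.
Proof.
move=> u1; have h := EE_QQ u1 p; have h0 := EE_gt0 p u1.
by nra.
Qed.

Lemma continuous_EE u : continuous (EE u).
Proof.
move=> p; apply: cvgB; apply: cvgM; try exact: cvg_cst; [exact: continuous_p0|exact: cvg_id].
Qed.

Lemma continuous_QQ u : continuous (QQ u).
Proof.
move=> p; apply: cvgB; apply: cvgM; try exact: cvg_cst; [exact: continuous_p0|exact: cvg_id].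
Qed.

Lemma continuous_ekern u n z : continuous (ekern u n z).
Proof.
move=> p; apply: cvgM; last exact: continuous_p0V.
apply: cvgM.
  apply: (@continuous_comp _ _ _ (EE u) (fun x => x ^+ n)); first exact: continuous_EE.
  exact: exprn_continuous.
apply: (@continuous_comp _ _ _ (fun x => - z * EE u x) expR); last exact: continuous_expR.
by apply: cvgM; [exact: cvg_cst|exact: continuous_EE].
Qed.

Lemma ekern_ge0 u n z p : `|u| < 1 -> 0 <= ekern u n z p.
Proof.
by move=> u1; rewrite divr_ge0 ?mulr_ge0 ?exprn_ge0 ?expR_ge0 ?(ltW (p0_gt0 p))// ltW// EE_gt0.
Qed.

Lemma ekern_boost u n z s : `|u| < 1 ->
  ekern u n z (boost u s) * (p0 (boost u s) / p0 s) = kern n z s.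
Proof.
move=> u1; rewrite /ekern EE_boost// /kern; have h1 := p0_neq0 s.
by have h2 := p0_neq0 (boost u s); field; rewrite h1 h2.
Qed.

Lemma kernN n z s : kern n z (- s) = kern n z s. Proof. by rewrite /kern p0N. Qed.

Lemma integral_kern n z : 0 < z ->
  (\int[lebesgue_measure]_(s in `[0%R, +oo[) (kern n z s)%:E = (mom z n)%:E)%E.
Proof.
move=> z0; rewrite /mom /Rintegral fineK//.
exact: (@integrable_fin_num _ _ _ lebesgue_measure _ (measurable_itv _) _ (integrable_kern n z0)).
Qed.

Lemma integral_ekern u n z : `|u| < 1 -> 0 < z ->
  (\int[lebesgue_measure]_p (ekern u n z p)%:E = (2 * mom z n)%:E)%E.
Proof.
move=> u1 z0; rewrite (integral_boost u1 (@continuous_ekern _ _ _) (fun p => ekern_ge0 n z p u1)).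
under eq_integral do rewrite ekern_boost//.
rewrite (integral_symm (@continuous_kern _ _ _) (kern_ge0 _ _)).
under eq_integral do rewrite kernN.
under eq_integral do rewrite -mulr2n -mulr_natl EFinM.
rewrite ge0_integralZl//.
- by rewrite integral_kern.
- by apply/measurable_EFinP; exact: measurable_kern.
- by move=> s _; rewrite lee_fin kern_ge0.
Qed.

Lemma integrable_ekern u n z : `|u| < 1 -> 0 < z ->
  lebesgue_measure.-integrable setT (EFin \o ekern u n z).
Proof.
move=> u1 z0; apply/integrableP; split.
  by apply/measurable_EFinP; apply: continuous_measurable_fun; exact: continuous_ekern.
rewrite (_ : (\int[_]_(_ in _) _)%E = (2 * mom z n)%:E) ?ltry//.
rewrite -(integral_ekern n u1 z0); apply: eq_integral => p _.
by rewrite /= ger0_norm// ekern_ge0.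
Qed.

(** Adding the energy makes the odd integrand nonnegative. *)
Lemma integral_okernD u n z : `|u| < 1 -> 0 < z ->
  (\int[lebesgue_measure]_p (okern u n z p + ekern u n.+1 z p)%:E = (2 * mom z n.+1)%:E)%E.
Proof.
move=> u1 z0.
have E p : okern u n z p + ekern u n.+1 z p = (QQ u p + EE u p) * ekern u n z p.
  by rewrite /okern /ekern exprS; ring.
rewrite (@integral_boost u (fun p => okern u n z p + ekern u n.+1 z p) u1).
- have kE s : (okern u n z (boost u s) + ekern u n.+1 z (boost u s)) * (p0 (boost u s) / p0 s)
    = (p0 s - s) * kern n z s.
    by rewrite E -mulrA ekern_boost// QQ_boost// EE_boost//; ring.
  under eq_integral do rewrite kE.
  rewrite (@integral_symm (fun s => (p0 s - s) * kern n z s)).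
  + have k2 s : (p0 s - s) * kern n z s + (p0 (- s) - - s) * kern n z (- s) = 2 * kern n.+1 z s.
      by rewrite kernN p0N kernS; ring.
    under eq_integral do rewrite k2 EFinM.
    rewrite ge0_integralZl//; first by rewrite integral_kern.
      by apply/measurable_EFinP; exact: measurable_kern.
    by move=> s _; rewrite lee_fin kern_ge0.
  + move=> s; apply: cvgM; last exact: continuous_kern.
    by apply: cvgB; [exact: continuous_p0|exact: cvg_id].
  + move=> s; rewrite mulr_ge0 ?kern_ge0// subr_ge0.
    by rewrite (le_trans (ler_norm _))// p0_ge_norm.
- move=> p; apply: cvgD; last exact: continuous_ekern.
  by apply: cvgM; [exact: continuous_QQ|exact: continuous_ekern].
- move=> p; rewrite E mulr_ge0 ?ekern_ge0//.
  by have := QQ_ge p u1; lra.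
Qed.

Lemma integrable_okern u n z : `|u| < 1 -> 0 < z ->
  lebesgue_measure.-integrable setT (EFin \o okern u n z).
Proof.
move=> u1 z0.
apply: (@le_integrable _ _ _ lebesgue_measure _ _ _ (EFin \o ekern u n.+1 z)) => //.
- apply/measurable_EFinP; apply: continuous_measurable_fun => p.
  by apply: cvgM; [exact: continuous_QQ|exact: continuous_ekern].
- move=> p _; rewrite lee_fin /okern normrM.
  have -> : ekern u n.+1 z p = EE u p * ekern u n z p by rewrite /ekern exprS; ring.
  rewrite [leRHS]normrM ler_wpM2r// (gtr0_norm (EE_gt0 p u1)).
  have h1 := EE_QQ u1 p; have h2 := EE_gt0 p u1.
  by rewrite ler_norml QQ_ge//=; nra.
- exact: integrable_ekern.
Qed.

Lemma integral_okern u n z : `|u| < 1 -> 0 < z ->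
  \int[lebesgue_measure]_p okern u n z p = 0.
Proof.
move=> u1 z0.
have h : \int[lebesgue_measure]_p (okern u n z p + ekern u n.+1 z p) = 2 * mom z n.+1.
  by rewrite /Rintegral integral_okernD.
have h' : \int[lebesgue_measure]_p ekern u n.+1 z p = 2 * mom z n.+1.
  by rewrite /Rintegral integral_ekern.
move: h; rewrite RintegralD//; [|exact: integrable_okern|exact: integrable_ekern].
by rewrite h' => /eqP; rewrite -subr_eq0 addrK => /eqP.
Qed.

(** In the comoving frame the integrand is the sum of an even and of an odd
    function of the momentum. *)
Lemma integral_horner_EE u z (r s : {poly R}) : `|u| < 1 -> 0 < z ->
  \int[lebesgue_measure]_p
    ((r.[EE u p] + QQ u p * s.[EE u p]) * expR (- z * EE u p) / p0 p) = 2 * eform z r.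
Proof.
move=> u1 z0; have ie i := integrable_ekern i u1 z0; have io i := integrable_okern i u1 z0.
have [ier er] := Rintegral_lincomb (fun i => r`_i) (size r) measurableT ie.
have [ios os] := Rintegral_lincomb (fun i => s`_i) (size s) measurableT io.
transitivity (\int[lebesgue_measure]_p (\sum_(i < size r) r`_i * ekern u i z p
    + \sum_(i < size s) s`_i * okern u i z p)).
  apply: eq_Rintegral => p _; rewrite !horner_coef mulr_sumr mulrDl mulrDl !mulr_suml.
  by congr (_ + _); apply: eq_bigr => i _; rewrite /okern /ekern; ring.
rewrite RintegralD// er os [X in _ + X]big1 ?addr0; last first.
  by move=> i _; rewrite integral_okern// mulr0.
rewrite /eform /momform mulr_sumr; apply: eq_bigr => i _.
by rewrite /Rintegral integral_ekern//=; ring.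
Qed.

End InnerProduct.

(** * Orthonormal polynomials and zeros *)

Section OrthonormalPolynomials.
Context {R : realType}.
Variables (w : {poly R} -> R) (Q : nat -> {poly R}).
Hypothesis wD : forall r s, w (r + s) = w r + w s.
Hypothesis wZ : forall a r, w (a *: r) = a * w r.
Hypothesis sizeQ : forall n, size (Q n) = n.+1.
Hypothesis orthoQ : forall m n, w (Q m * Q n) = (m == n)%:R.

Let w0 : w 0 = 0. Proof. by rewrite -(scale0r (0 : {poly R})) wZ mul0r. Qed.

Let wsum I (t : seq I) (B : pred I) (F : I -> {poly R}) :
  w (\sum_(i <- t | B i) F i) = \sum_(i <- t | B i) w (F i).
Proof. by elim/big_rec2: _ => [|i x y _ <-]; rewrite ?w0 ?wD. Qed.

Let leadQ n : lead_coef (Q n) = (Q n)`_n. Proof. by rewrite lead_coefE sizeQ. Qed.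

Let leadQ0 n : lead_coef (Q n) != 0.
Proof. by rewrite lead_coef_eq0 -size_poly_gt0 sizeQ. Qed.

Lemma ortho_expand n (r : {poly R}) : (size r <= n)%N -> r = \sum_(i < n) w (r * Q i) *: Q i.
Proof.
elim: n r => [|n IH] r rn.
  by rewrite big_ord0; apply/eqP; rewrite -size_poly_leq0.
pose c := r`_n / lead_coef (Q n); pose s := r - c *: Q n.
have sn : (size s <= n)%N.
  apply/leq_sizeP => j; rewrite leq_eqVlt => /predU1P[<-|nj].
    by rewrite coefB coefZ /c -leadQ divfK ?subrr.
  rewrite coefB coefZ !nth_default ?mulr0 ?subr0// ?sizeQ//.
  exact: leq_trans rn nj.
have rE : r = s + c *: Q n by rewrite subrK.
have sQ : w (s * Q n) = 0.
  rewrite {1}(IH s sn) mulr_suml wsum big1// => i _.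
  by rewrite -scalerAl wZ orthoQ ltn_eqF ?mulr0.
have wE i : w (r * Q i) = w (s * Q i) + c * (n == i)%:R.
  by rewrite rE mulrDl wD -scalerAl wZ orthoQ.
rewrite big_ord_recr/= wE sQ eqxx mulr1 add0r {1}rE {1}(IH s sn).
congr (_ + _); apply: eq_bigr => i _.
by rewrite wE gtn_eqF ?mulr0 ?addr0.
Qed.

Lemma ortho_low n (r : {poly R}) : (size r <= n)%N -> w (r * Q n) = 0.
Proof.
move=> rn; rewrite {1}(ortho_expand rn) mulr_suml wsum big1// => i _.
by rewrite -scalerAl wZ orthoQ ltn_eqF ?mulr0.
Qed.

Lemma ortho_lead n (r : {poly R}) : (size r <= n.+1)%N -> w (r * Q n) = r`_n / lead_coef (Q n).
Proof.
move=> rn; set c := r`_n / lead_coef (Q n); pose s := r - c *: Q n.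
have sn : (size s <= n)%N.
  apply/leq_sizeP => j; rewrite leq_eqVlt => /predU1P[<-|nj].
    by rewrite coefB coefZ -leadQ divfK ?subrr.
  rewrite coefB coefZ !nth_default ?mulr0 ?subr0// ?sizeQ//.
  exact: leq_trans rn nj.
have -> : r = s + c *: Q n by rewrite subrK.
by rewrite mulrDl wD ortho_low// -scalerAl wZ orthoQ eqxx mulr1 add0r.
Qed.

(** The sum is the reproducing kernel at [x] of the polynomials of degree less
    than [n]. *)
Lemma repro n x (r : {poly R}) : (size r <= n)%N ->
  w ((\sum_(i < n) (Q i).[x] *: Q i) * r) = r.[x].
Proof.
move=> rn; rewrite [in RHS](ortho_expand rn) horner_sum mulr_suml wsum.
by apply: eq_bigr => i _; rewrite -scalerAl wZ hornerZ mulrC [Q i * r]mulrC.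
Qed.

End OrthonormalPolynomials.

Section Zeros.
Context {R : realType}.
Implicit Types (r : {poly R}) (s : seq R).

Definition rootprod s : {poly R} := \prod_(x <- s) ('X - x%:P).

Lemma size_rootprod s : size (rootprod s) = (size s).+1.
Proof. by rewrite size_prod_XsubC. Qed.

Lemma horner_rootprod s y : (rootprod s).[y] = \prod_(x <- s) (y - x).
Proof. by rewrite horner_prod; apply: eq_bigr => x _; rewrite hornerXsubC. Qed.

(** Without a root in ]1, oo[ a polynomial keeps its sign there; otherwise a
    linear factor is split off, and it enters the corrector or, by squaring,
    leaves it. *)
Lemma sign_corrector r : r != 0 ->
  exists e : R, exists s : seq R, [/\ e \in [:: 1; -1], uniq s,
    all (fun x => 1 < x) s, all (root r) s &
    forall y, 1 <= y -> 0 <= e * (r * rootprod s).[y]].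
Proof.
have [n] := ubnP (size r); elim: n r => // n IH r; rewrite ltnS => rn r0.
have [[x x1 rx]|nox] := pselect (exists2 x, 1 < x & root r x).
  have [q rE] : exists q, r = q * ('X - x%:P) by apply/factor_theorem.
  have q0 : q != 0 by apply: contra_neq r0 => q0; rewrite rE q0 mul0r.
  have qr : (size q < size r)%N.
    by rewrite rE size_Mmonic ?monicXsubC// size_XsubC addn2/=.
  have [e [s [e1 us s1 rs es]]] := IH q (leq_trans qr rn) q0.
  have rqr y : root q y -> root r y by move=> qy; rewrite rE rootM qy.
  have [xs|xs] := boolP (x \in s).
    exists e, (rem x s); split => //.
    - exact: rem_uniq.
    - by apply/allP => y /mem_rem ys; exact: (allP s1).
    - by apply/allP => y /mem_rem ys; apply: rqr; exact: (allP rs).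
    - move=> y y1; have := es y y1.
      by rewrite rE /rootprod (perm_big _ (perm_to_rem xs)) big_cons -mulrA.
  exists e, (x :: s); split => //.
  - by rewrite /= xs.
  - by rewrite /= x1.
  - by rewrite /= rx/=; apply: sub_all rs => y; exact: rqr.
  - move=> y y1; have := es y y1.
    rewrite /rootprod big_cons rE !hornerM hornerXsubC.
    set a := q.[y]; set b := _.[y] => h.
    have -> : e * (a * (y - x) * ((y - x) * b)) = e * (a * b) * (y - x) ^+ 2 by ring.
    by rewrite mulr_ge0// sqr_ge0.
have rn0 y : 1 < y -> r.[y] != 0 by move=> y1; apply/negP => ry; apply: nox; exists y.
have same_sign x y : 1 <= x -> x < y -> 0 <= r.[x] * r.[y].
  move=> x1 xy; rewrite leNgt; apply/negP => h.
  have [t /andP[xt ty] rt] := poly_ivtoo (ltW xy) h.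
  by apply: nox; exists t => //; exact: le_lt_trans x1 xt.
pose e := Num.sg r.[2].
have r2 : r.[2] != 0 by apply: rn0; rewrite ltr1n.
exists e, [::]; split => //.
  by rewrite !inE /e; have := r2; rewrite -sgr_eq0; case: sgrP => // _; rewrite eqxx ?orbT.
move=> y y1; rewrite /rootprod big_nil mulr1.
have h : 0 <= r.[2] * r.[y].
  have [y2|y2|->] := ltgtP y 2; first by rewrite mulrC same_sign.
    by rewrite same_sign// ler1n.
  by rewrite -expr2 sqr_ge0.
by rewrite -(pmulr_rge0 _ (_ : 0 < `|r.[2]|)) ?normr_gt0// mulrA /e normrEsg
  [_ * _ * Num.sg _]mulrAC -expr2 sqr_sg r2 mul1r.
Qed.

End Zeros.

(** * The polynomials orthonormal for the Bessel weights *)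

Section BesselWeightPolynomials.
Context {R : realType} (P : bool -> R -> nat -> {poly R}).
Hypothesis hP : is_poly_family P.
Implicit Types (l : bool) (z x : R) (n k : nat).

(** The positive functional for which the [P l z n] are orthonormal. *)
Definition wform l z (r : {poly R}) : R := (mom z 1)^-1 * eform z (wgt l * r).

Lemma wformD l z (r s : {poly R}) : wform l z (r + s) = wform l z r + wform l z s.
Proof. by rewrite /wform mulrDr eformD mulrDr. Qed.

Lemma wformZ l z a (r : {poly R}) : wform l z (a *: r) = a * wform l z r.
Proof. by rewrite /wform -scalerAr eformZ mulrCA. Qed.

Lemma wform_true z (r : {poly R}) : wform true z r = wform false z (('X^2 - 1) * r).
Proof. by rewrite /wform /wgt mul1r. Qed.

Variable z : R.
Hypothesis z0 : 0 < z.

Lemma size_P l n : size (P l z n) = n.+1. Proof. by have [h _ _] := hP l z0. Qed.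

Lemma ortho_P l m n : wform l z (P l z m * P l z n) = (m == n)%:R.
Proof. by have [_ _ h] := hP l z0; rewrite -h innerw_eform. Qed.

Lemma cc_gt0 l n : 0 < cc P l z n. Proof. by have [_ h _] := hP l z0; exact: h. Qed.

Lemma cc_neq0 l n : cc P l z n != 0. Proof. exact/lt0r_neq0/cc_gt0. Qed.

Lemma P_neq0 l n : P l z n != 0. Proof. by rewrite -size_poly_gt0 size_P. Qed.

Lemma ccE l n : cc P l z n = (P l z n)`_n.
Proof. by rewrite /cc lead_coefE size_P. Qed.

Lemma wgt_ge0 l x : 1 <= x -> 0 <= (wgt l).[x].
Proof.
move=> x1; case: l; rewrite /wgt ?hornerC ?ler01// !hornerE.
by rewrite subr_ge0 -[leLHS](expr1n _ 2) lerXn2r ?nnegrE// (le_trans ler01).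
Qed.

Lemma wgt_neq0 l : wgt l != 0 :> {poly R}.
Proof.
case: l; rewrite /wgt ?oner_neq0//; apply/negP => /eqP/(congr1 (fun q : {poly R} => q.[0])).
by rewrite !hornerE expr0n/= sub0r => /eqP; rewrite oppr_eq0 oner_eq0.
Qed.

Lemma wform_gt0 l (r : {poly R}) : r != 0 -> (forall x, 1 <= x -> 0 <= r.[x]) -> 0 < wform l z r.
Proof.
move=> r0 rge0; rewrite /wform mulr_gt0 ?invr_gt0 ?mom_gt0//; apply: eform_gt0 => //.
  by rewrite mulf_neq0// wgt_neq0.
by move=> x x1; rewrite hornerM mulr_ge0 ?wgt_ge0 ?rge0.
Qed.

(** Fewer than [n] sign changes in ]1, oo[ would allow a polynomial of degree
    less than [n] to have a product of constant sign with [P l z n]. *)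
Lemma zeros_P l n : exists s : seq R, [/\ uniq s, all (fun x => 1 < x) s,
  size s = n & P l z n = cc P l z n *: rootprod s].
Proof.
have [e [s [e1 us s1 rs es]]] := sign_corrector (P_neq0 l n).
have sn : (size s <= n)%N.
  by have := max_poly_roots (P_neq0 l n) rs us; rewrite size_P ltnS.
have ns : (n <= size s)%N.
  rewrite leqNgt; apply/negP => ltsn.
  have e0 : e != 0 by move: e1; rewrite !inE => /orP[] /eqP->; rewrite ?oppr_eq0 oner_neq0.
  have : 0 < wform l z (e *: (P l z n * rootprod s)).
    apply: wform_gt0; last by move=> x x1; rewrite hornerZ es.
    by rewrite scaler_eq0 negb_or e0 mulf_neq0 ?P_neq0// -size_poly_gt0 size_rootprod.
  rewrite wformZ mulrC -[P l z n * _]mulrC (ortho_low (wformD l z) (wformZ l z) (size_P l) (ortho_P l)) ?mul0r ?ltxx//.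
  by rewrite size_rootprod.
have sE : size s = n by apply/eqP; rewrite eqn_leq sn ns.
exists s; split => //; apply: all_roots_prod_XsubC => //.
  by rewrite size_P sE.
by rewrite uniq_rootsE.
Qed.

Lemma rootsR_P l n s : uniq s -> P l z n = cc P l z n *: rootprod s ->
  perm_eq (rootsR (P l z n)) s.
Proof.
move=> us PE; apply: uniq_perm => //; first exact: uniq_roots.
move=> x; have := roots_on_rootsR (P_neq0 l n) x; rewrite /= => <-.
by rewrite [in root _]PE rootZ ?cc_neq0// root_prod_XsubC.
Qed.

Lemma sum_xx l n s : uniq s -> size s = n -> P l z n = cc P l z n *: rootprod s ->
  \sum_(1 <= i < n.+1) xx P l z i n = \sum_(x <- s) x.
Proof.
move=> us sn PE; have h := rootsR_P us PE.
rewrite -[RHS](perm_big _ h) [RHS](big_nth 0) (perm_size h) sn big_add1/=.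
by apply: eq_bigr.
Qed.

Lemma coef_rootprod (s : seq R) :
  ('X * rootprod s)`_(size s) = - \sum_(x <- s) x.
Proof.
case: s => [|x s]; first by rewrite /rootprod !big_nil mulr1 coefX oppr0.
by rewrite coefXM/= -(coefPn_prod_XsubC (ps := x :: s)).
Qed.

Lemma coef_XP l n : ('X * P l z n)`_n = - cc P l z n * \sum_(1 <= i < n.+1) xx P l z i n.
Proof.
have [s [us _ sn PE]] := zeros_P l n.
rewrite (sum_xx us sn PE) PE -scalerAr coefZ -[X in _`_X]sn coef_rootprod.
by rewrite mulrN mulNr.
Qed.

(** The weight of superscript 1 is [x ^ 2 - 1] times the other one, so the
    left-hand side is orthogonal to [P false z i] for [i < k]; having degree
    [k + 2], it has three coefficients left. Those of top and bottom index come
    from leading coefficients, the middle one from the sums of zeros. *)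
Lemma christoffel k : ('X^2 - 1) * P true z k =
  pp P z k *: P false z k + qq P z k *: P false z k.+1 + rr P z k.+1 *: P false z k.+2.
Proof.
set r := _ * P true z k.
have sr : (size r <= k.+3)%N.
  apply: leq_trans (size_polyMleq _ _) _; rewrite size_P.
  have h3 : (size (('X^2 - 1)%R : {poly R}) <= 3)%N.
    by rewrite (leq_trans (size_polyD _ _))// size_polyN size_polyXn size_poly1.
  by rewrite addnS/= addnC -[k.+3]addn3 leq_add2l.
have low i : (i < k)%N -> wform false z (r * P false z i) = 0.
  move=> ik; rewrite /r -mulrA -wform_true mulrC.
  by apply: (ortho_low (wformD true z) (wformZ true z) (size_P true) (ortho_P true)); rewrite size_P.
have wk : wform false z (r * P false z k) = pp P z k.
  rewrite /r -mulrA -wform_true mulrC.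
  rewrite (ortho_lead (wformD true z) (wformZ true z) (size_P true) (ortho_P true)) ?size_P//.
  by rewrite /pp ccE.
have r2 : r`_k.+2 = cc P true z k.
  by rewrite /r mulrBl mul1r coefB coefXnM/= subSS subSS subn0 ccE [X in _ - X]nth_default ?subr0// size_P.
have wk2 : wform false z (r * P false z k.+2) = rr P z k.+1.
  rewrite (ortho_lead (wformD false z) (wformZ false z) (size_P false) (ortho_P false))//.
  by rewrite r2.
have := ortho_expand (wformD false z) (wformZ false z) (size_P false) (ortho_P false) sr.
rewrite !big_ord_recr/= big1 ?add0r; last by move=> i _; rewrite low// scale0r.
rewrite wk wk2; set b := wform _ _ _ => rE; rewrite rE.
suff -> : b = qq P z k by [].
have r1 : r`_k.+1 = - cc P true z k * \sum_(1 <= i < k.+1) xx P true z i k.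
  rewrite -coef_XP /r mulrBl mul1r coefB [X in _ - X]nth_default ?size_P// subr0.
  by rewrite expr2 -mulrA [LHS]coefXM.
have p1 : (P false z k.+2)`_k.+1 = - cc P false z k.+2 * \sum_(1 <= i < k.+3) xx P false z i k.+2.
  by rewrite -coef_XP coefXM.
move: r1; rewrite rE !coefD !coefZ p1 -ccE [(P false z k)`_k.+1]nth_default ?size_P//.
rewrite mulr0 add0r /qq /rr/=.
have h1 := cc_neq0 false k.+1; have h2 := cc_neq0 false k.+2.
move=> H; apply: (mulIf h1).
move/(canRL (addrK _)): H => ->.
by field; rewrite h1 h2.
Qed.

(** All zeros are closer to 1 than to -1. *)
Lemma norm_horner_P_lt l n : `|(P l z n.+1).[1]| < `|(P l z n.+1).[-1]|.
Proof.
have [s [us s1 sn PE]] := zeros_P l n.+1.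
rewrite PE !hornerZ !horner_rootprod !normrM ltr_pM2l ?normr_gt0 ?cc_neq0//.
have le (t : seq R) : all (fun x => 1 < x) t ->
    0 < `|\prod_(x <- t) (1 - x)| <= `|\prod_(x <- t) (-1 - x)|.
  elim: t => [|x t IH]; first by rewrite !big_nil normr1 ltr01 lexx.
  move=> /= /andP[x1 /IH /andP[h1 h2]]; rewrite !big_cons !normrM.
  have -> : `|1 - x| = x - 1 by rewrite ltr0_norm; lra.
  have -> : `|-1 - x| = x + 1 by rewrite ltr0_norm; lra.
  by apply/andP; split; nra.
case: s s1 sn {us PE} => // x s /= /andP[x1 /le /andP[h1 h2]] _.
rewrite !big_cons !normrM.
have -> : `|1 - x| = x - 1 by rewrite ltr0_norm; lra.
have -> : `|-1 - x| = x + 1 by rewrite ltr0_norm; lra.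
by nra.
Qed.

End BesselWeightPolynomials.

(** * Differentiability in the inverse temperature *)

Section PolynomialsWithParameter.
Context {R : realType}.
Implicit Types (A B : R -> {poly R}) (z : R).

(** [A] is, for positive parameters, a differentiable path in a space of
    polynomials of bounded degree. *)
Definition pdiff A z :=
  (exists N, forall y, 0 < y -> (size (A y) <= N)%N) /\
  forall i, derivable (fun y => (A y)`_i) z 1.

(** The derivative of such a path is a polynomial of the same bounded degree. *)
Definition pder A z (A' : {poly R}) :=
  exists N, [/\ forall y, 0 < y -> (size (A y) <= N)%N, (size A' <= N)%N &
    forall i, is_derive z 1 (fun y => (A y)`_i) A'`_i].

Lemma is_derive_eq_pos (f g : R -> R) z (d : R) : 0 < z -> (forall y, 0 < y -> f y = g y) ->
  is_derive z 1 f d -> is_derive z 1 g d.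
Proof.
move=> z0 fg; apply: near_eq_is_derive; near=> y; apply: fg.
by near: y; exact: lt_nbhsr.
Unshelve. all: by end_near. Qed.

Lemma pdiff_pder A z : 0 < z -> pdiff A z -> exists A' : {poly R}, pder A z A'.
Proof.
move=> z0 [[N sA] dA].
exists (\poly_(i < N) 'D_1 (fun y => (A y)`_i) z); exists N; split => [//||i]; first exact: size_poly.
rewrite coef_poly; case: ifPn => iN; first exact/derivableP.
apply: (@is_derive_eq_pos (fun=> 0)) => //.
move=> y y0; rewrite nth_default// (leq_trans (sA y y0))// leqNgt//.
Qed.

Lemma pdiff_eq A B z : 0 < z -> (forall y, 0 < y -> A y = B y) -> pdiff A z -> pdiff B z.
Proof.
move=> z0 AB [[N sA] dA]; split; first by exists N => y y0; rewrite -AB// sA.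
move=> i; have d := @derivableP _ _ _ _ _ _ (dA i).
have [] // := @is_derive_eq_pos _ (fun y => (B y)`_i) z _ z0 _ d.
by move=> y y0; rewrite AB.
Qed.

Lemma pdiff_cst (r : {poly R}) z : pdiff (fun=> r) z.
Proof. by split; [exists (size r)|move=> i; exact: derivable_cst]. Qed.

Lemma pdiffD A B z : pdiff A z -> pdiff B z -> pdiff (fun y => A y + B y) z.
Proof.
move=> [[N sA] dA] [[N' sB] dB]; split.
  exists (maxn N N') => y y0; apply: leq_trans (size_polyD _ _) _.
  by rewrite geq_max !leq_max sA//= sB// orbT.
by move=> i; under eq_fun do rewrite coefD; exact: derivableD.
Qed.

Lemma pdiffZ (c : R -> R) A z : derivable c z 1 -> pdiff A z -> pdiff (fun y => c y *: A y) z.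
Proof.
move=> dc [[N sA] dA]; split.
  by exists N => y y0; rewrite (leq_trans (size_scale_leq _ _))// sA.
by move=> i; under eq_fun do rewrite coefZ; exact: derivableM.
Qed.

Lemma pdiff_sum n (F : nat -> R -> {poly R}) z : (forall i, (i < n)%N -> pdiff (F i) z) ->
  pdiff (fun y => \sum_(i < n) F i y) z.
Proof.
elim: n => [|n IH] dF.
  by under eq_fun do rewrite big_ord0; exact: pdiff_cst.
under eq_fun do rewrite big_ord_recr/=.
apply: pdiffD; last exact: dF.
by apply: IH => i ni; apply: dF; exact: ltnW.
Qed.

Lemma derivable_sumr n (f : 'I_n -> R -> R) z : (forall i, derivable (f i) z 1) ->
  derivable (fun y => \sum_(i < n) f i y) z 1.
Proof.
move=> df; rewrite (_ : (fun y => _) = \sum_(i < n) f i); first exact: derivable_sum.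
by apply/funext => y; rewrite fct_sumE.
Qed.

Lemma pdiffM A B z : pdiff A z -> pdiff B z -> pdiff (fun y => A y * B y) z.
Proof.
move=> [[N sA] dA] [[N' sB] dB]; split.
  exists (N + N')%N => y y0; apply: leq_trans (size_polyMleq _ _) _.
  by rewrite (leq_trans (leq_pred _))// leq_add// ?sA ?sB.
move=> i; under eq_fun do rewrite coefM.
by apply: derivable_sumr => j; exact: derivableM.
Qed.

Lemma is_derive_sumr n (f : 'I_n -> R -> R) (df : 'I_n -> R) z :
  (forall i, is_derive z 1 (f i) (df i)) ->
  is_derive z 1 (fun y => \sum_(i < n) f i y) (\sum_(i < n) df i).
Proof.
move=> h; rewrite (_ : (fun y => _) = \sum_(i < n) f i); first exact: is_derive_sum.
by apply/funext => y; rewrite fct_sumE.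
Qed.

Lemma eform_mulX z (r : {poly R}) N : (size r <= N)%N ->
  eform z ('X * r) = \sum_(i < N) r`_i * mom z i.+1.
Proof.
move=> rN; have -> : r = \sum_(i < N) r`_i *: 'X^i.
  apply/polyP => i; rewrite coef_sum.
  have [iN|iN] := ltnP i N.
    rewrite (bigD1 (Ordinal iN))//= coefZ coefXn eqxx mulr1 big1 ?addr0// => j ji.
    by rewrite coefZ coefXn eq_sym (negbTE (_ : (j : nat) != i)) ?mulr0.
  rewrite nth_default ?(leq_trans rN)// big1// => j _.
  by rewrite coefZ coefXn gtn_eqF ?mulr0// (leq_trans _ iN).
rewrite mulr_sumr eform_sum; apply: eq_bigr => i _.
rewrite -scalerAr eformZ -exprS eformXn; congr (_ * _).
rewrite coef_sum (bigD1 i)//= coefZ coefXn eqxx mulr1 big1 ?addr0// => j ji.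
by rewrite coefZ coefXn eq_sym (negbTE (_ : (j : nat) != i)) ?mulr0.
Qed.

(** The second term is due to the weight, whose exponential depends on [z]. *)
Lemma is_derive_eform A z (A' : {poly R}) : 0 < z -> pder A z A' ->
  is_derive z 1 (fun y => eform y (A y)) (eform z (A' - 'X * A z)).
Proof.
move=> z0 [N [sA sA' dA]].
apply: (@is_derive_eq_pos (fun y => \sum_(i < N) (A y)`_i * mom y i)) => //.
  by move=> y y0; rewrite /eform (momform_wide _ (sA y y0)).
rewrite eformB (eform_mulX _ (sA z z0)) {1}/eform (momform_wide _ sA') -sumrB.
apply: is_derive_sumr => i.
have h1 := dA i; have h2 := is_derive_mom i z0.
by apply: is_derive_eq; rewrite /GRing.scale/=; ring.
Qed.

Lemma is_derive_horner_path A z (A' : {poly R}) x : 0 < z -> pder A z A' ->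
  is_derive z 1 (fun y => (A y).[x]) A'.[x].
Proof.
move=> z0 [N [sA sA' dA]].
apply: (@is_derive_eq_pos (fun y => \sum_(i < N) (A y)`_i * x ^+ i)) => //.
  by move=> y y0; rewrite (horner_coef_wide _ (sA y y0)).
rewrite (horner_coef_wide _ sA'); apply: is_derive_sumr => i.
have h1 := dA i.
by apply: is_derive_eq; rewrite /GRing.scale/=; ring.
Qed.

Lemma pder_cstM A z (A' r : {poly R}) : pder A z A' -> pder (fun y => A y * r) z (A' * r).
Proof.
move=> [N [sA sA' dA]]; exists (N + size r)%N; split.
- move=> y y0; apply: leq_trans (size_polyMleq _ _) _.
  by rewrite (leq_trans (leq_pred _))// leq_add2r sA.
- apply: leq_trans (size_polyMleq _ _) _.
  by rewrite (leq_trans (leq_pred _))// leq_add2r.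
- move=> i; rewrite coefM; under eq_fun do rewrite coefM.
  apply: is_derive_sumr => j; have h1 := dA j.
  by apply: is_derive_eq; rewrite /GRing.scale/=; ring.
Qed.

End PolynomialsWithParameter.

Section SmoothnessInParameter.
Context {R : realType} (P : bool -> R -> nat -> {poly R}).
Hypothesis hP : is_poly_family P.

Definition gram_schmidt l (z : R) n : {poly R} :=
  'X^n - \sum_(i < n) wform l z ('X^n * P l z i) *: P l z i.

(** Orthonormality and positive leading coefficients determine the family. *)
Lemma P_gram_schmidt l z n : 0 < z ->
  P l z n = (Num.sqrt (wform l z (gram_schmidt l z n * gram_schmidt l z n)))^-1
            *: gram_schmidt l z n.
Proof.
move=> z0; set g := gram_schmidt l z n; set c := cc P l z n.
have c0 : 0 < c := cc_gt0 hP z0 l n.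
have PE : P l z n = c *: g.
  have sn : (size (P l z n - c *: 'X^n)%R <= n)%N.
    apply/leq_sizeP => j; rewrite leq_eqVlt => /predU1P[<-|nj].
      by rewrite coefB coefZ coefXn eqxx mulr1 /c (ccE hP z0) subrr.
    by rewrite coefB coefZ coefXn gtn_eqF// mulr0 subr0 nth_default// (size_P hP z0).
  have := ortho_expand (wformD l z) (wformZ l z) (size_P hP z0 l) (ortho_P hP z0 l) sn.
  move=> /(canRL (subrK _)) ->; rewrite /g /gram_schmidt scalerBr addrC; congr (_ + _).
  rewrite scaler_sumr -sumrN; apply: eq_bigr => i _.
  rewrite mulrBl wformD (ortho_P hP z0) gtn_eqF// add0r -scalerAl -scaleNr wformZ.
  by rewrite scalerA -scaleNr mulNr.
have h : c ^+ 2 * wform l z (g * g) = 1.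
  have := ortho_P hP z0 l n n; rewrite eqxx => E1; rewrite [RHS](esym E1).
  rewrite PE (_ : c *: g * (c *: g) = c ^+ 2 *: (g * g)) ?wformZ//.
  by rewrite -scalerAl -scalerAr scalerA expr2.
rewrite [LHS]PE.
suff -> : Num.sqrt (wform l z (g * g)) = c^-1 by rewrite invrK.
have -> : wform l z (g * g) = c^-1 ^+ 2.
  by apply: (mulfI (_ : c ^+ 2 != 0)); rewrite ?expf_neq0 ?gt_eqF// h exprVn mulfV// expf_neq0 ?gt_eqF.
by rewrite sqrtr_sqr gtr0_norm// invr_gt0.
Qed.

Lemma derivable_wform l z (A : R -> {poly R}) : 0 < z -> pdiff A z ->
  derivable (fun y => wform l y (A y)) z 1.
Proof.
move=> z0 dA.
have [A' hA] := pdiff_pder z0 (pdiffM (pdiff_cst (wgt l) z) dA).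
have [d1 _] := is_derive_eform z0 hA; have [d2 _] := is_derive_mom 1 z0.
apply: derivableM => //; apply: derivableV => //.
by rewrite gt_eqF// mom_gt0.
Qed.

(** The Gram-Schmidt process only uses operations that preserve
    differentiability in the parameter. *)
Lemma pdiff_P l z n : 0 < z -> pdiff (fun y => P l y n) z.
Proof.
move=> z0; elim/ltn_ind: n => n IH.
have dg : pdiff (fun y => gram_schmidt l y n) z.
  apply: pdiffD; first exact: pdiff_cst.
  under eq_fun do rewrite -scaleN1r.
  apply: pdiffZ; first exact: derivable_cst.
  apply: (@pdiff_sum _ n (fun i y => wform l y ('X^n * P l y i) *: P l y i)) => i ni.
  apply: pdiffZ; last exact: IH.
  by apply: derivable_wform => //; apply: pdiffM; [exact: pdiff_cst|exact: IH].
apply: (@pdiff_eq _ _ _ z z0 (fun y y0 => esym (P_gram_schmidt l n y0))).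
have W0 : 0 < wform l z (gram_schmidt l z n * gram_schmidt l z n).
  have := P_gram_schmidt l n z0; have := P_neq0 hP z0 l n.
  have [/eqP|] := eqVneq (gram_schmidt l z n) 0.
    by move=> /eqP-> /eqP h1 h2; case: h1; rewrite h2 scaler0.
  move=> g0 _ _; apply: wform_gt0 => //; first by rewrite mulf_neq0.
  by move=> x _; rewrite hornerM -expr2 sqr_ge0.
apply: pdiffZ => //; apply: derivableV; first by rewrite gt_eqF// sqrtr_gt0.
have dW : derivable (fun y => wform l y (gram_schmidt l y n * gram_schmidt l y n)) z 1.
  by apply: derivable_wform => //; exact: pdiffM.
have [ds _] := is_derive1_sqrt W0.
apply/derivable1_diffP; apply: (@differentiable_comp _ _ _ _ (fun y => wform l y _) (@Num.sqrt R)).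
  exact/derivable1_diffP.
exact/derivable1_diffP.
Qed.

End SmoothnessInParameter.

(** * Orderings of the basis and the zero eigenvector *)

Section SlotOrdering.

Definition unslot (s : bool * nat) : nat :=
  if s.1 then s.2.*2.+2 else s.2.*2.-1.

Lemma slotK : cancel slot unslot.
Proof.
move=> k; rewrite /slot /unslot; have [->//|k0] := eqVneq k 0%N.
have [ok|ok] := boolP (odd k) => /=.
  by rewrite uphalf_half ok doubleD/= -[in RHS](odd_double_half k) ok.
have h0 : (0 < k./2)%N by rewrite half_gt0; case: k k0 ok => [|[]].
by rewrite -doubleS prednK// -[RHS](odd_double_half k) (negbTE ok).
Qed.

Lemma unslotK : cancel unslot slot.
Proof.
move=> [[] n]; rewrite /slot /unslot/=.
  by rewrite odd_double/= doubleK.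
by case: n => [|n] //; rewrite doubleS/= odd_double/= doubleK.
Qed.

Lemma slot_ge5 k : (5 <= k)%N -> ((if (slot k).1 then 2 else 3) <= (slot k).2)%N.
Proof.
move=> k5; case E : (slot k) => [l n]; have := slotK k; rewrite E /unslot/=.
by case: l {E} => kE; move: k5; rewrite -kE; case: n {kE} => [|[|[|n]]].
Qed.

End SlotOrdering.

Section BlockOrdering.
Context {R : realType} (M : nat).

Definition block_slot (i : 'I_(M.+1 + M)) : bool * nat :=
  match fintype.split i with inl n => (false, n : nat) | inr n => (true, n : nat) end.

Lemma block_slot_lshift (i : 'I_M.+1) : block_slot (lshift M i) = (false, i : nat).
Proof. by rewrite /block_slot (unsplitK (inl i)). Qed.

Lemma block_slot_rshift (i : 'I_M) : block_slot (rshift M.+1 i) = (true, i : nat).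
Proof. by rewrite /block_slot (unsplitK (inr i)). Qed.

Lemma block_slot_inj : injective block_slot.
Proof.
move=> i j; rewrite -(splitK i) -(splitK j).
case: (fintype.split i) => a; case: (fintype.split j) => b /=;
  rewrite ?block_slot_lshift ?block_slot_rshift// => -[] /val_inj -> //.
Qed.

Lemma unslot_block_lt i : (unslot (block_slot i) < M.+1 + M)%N.
Proof.
rewrite -(splitK i); case: (fintype.split i) => a /=;
  rewrite ?block_slot_lshift ?block_slot_rshift /unslot/=; have := ltn_ord a.
  by move=> aM; lia.
by move=> aM; lia.
Qed.

Lemma Pperm_orthogonal : (Pperm R M)^T *m Pperm R M = 1%:M.
Proof.
apply/matrixP => i j; rewrite !mxE.
have PE k i' : (Pperm R M) k i' = (slot k == block_slot i')%:R by rewrite mxE.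
under eq_bigr do rewrite mxE !PE.
have [<-|ij] := eqVneq i j; last first.
  rewrite big1// => k _; case: eqP => [->|_]; last by rewrite mul0r.
  by rewrite mul1r; case: eqP => // /block_slot_inj/eqP; rewrite (negbTE ij).
rewrite (bigD1 (Ordinal (unslot_block_lt i)))//= unslotK eqxx mulr1 big1 ?addr0// => k.
move=> ki; case: eqP => [h|_]; last by rewrite mul0r.
by exfalso; move/eqP: ki; apply; apply: val_inj; rewrite /= -h slotK.
Qed.

Lemma Pperm_inj (v w : 'cV[R]_(M.+1 + M)) : Pperm R M *m v = Pperm R M *m w -> v = w.
Proof. by move/(congr1 (mulmx (Pperm R M)^T)); rewrite !mulmxA Pperm_orthogonal !mul1mx. Qed.

Lemma Pperm_col_true (u : 'cV[R]_M.+1) (k : 'I_(M.+1 + M)) : (slot k).1 ->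
  (Pperm R M *m col_mx u 0) k 0 = 0.
Proof.
move=> sk; rewrite mxE big_split_ord/= !big1 ?addr0// => i _.
  by rewrite col_mxEd [X in _ * X]mxE mulr0.
rewrite mxE -/(block_slot _) block_slot_lshift; case: eqP => [h|]; last by rewrite mul0r.
by rewrite h in sk.
Qed.

End BlockOrdering.

Section ZeroEigenvector.
Context {R : realType} (P : bool -> R -> nat -> {poly R}).
Hypothesis hP : is_poly_family P.
Variable z : R.
Hypothesis z0 : 0 < z.

(** Row [k] of the matrix is the expansion of [(x ^ 2 - 1) * P true z k],
    which vanishes at 1 and -1; only the last row is truncated. *)
Lemma Jmix_horner M (x : R) (k : 'I_M) : x ^+ 2 = 1 ->
  (Jmix P z M *m (\col_(i < M.+1) (P false z i).[x])) k 0 =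
  - (rr P z M * (P false z M.+1).[x] *+ (k.+1 == M :> nat)).
Proof.
move=> x1.
have chr : pp P z k * (P false z k).[x] + qq P z k * (P false z k.+1).[x]
    + rr P z k.+1 * (P false z k.+2).[x] = 0.
  have := congr1 (fun q : {poly R} => q.[x]) (christoffel hP z0 k).
  by rewrite !hornerE x1 subrr mul0r => <-.
have kM := ltn_ord k.
rewrite mxE.
have kM1 : (k < M.+1)%N by exact: ltnW.
have kM2 : (k.+1 < M.+1)%N by [].
rewrite (bigD1 (Ordinal kM1))//= (bigD1 (Ordinal kM2))/=; last first.
  by apply/eqP => -[] /eqP; rewrite eqn_leq ltnn.
rewrite !mxE/= eqxx (gtn_eqF (ltnSn k)) eqxx addrA.
have [kE|kM'] := eqVneq k.+1 M.
  rewrite big1 ?addr0; last first.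
    move=> i /andP[i1 i2]; rewrite !mxE.
    rewrite (negbTE (_ : (i : nat) != k)); last by apply: contra i1 => /eqP h; apply/eqP/val_inj.
    rewrite (negbTE (_ : (i : nat) != k.+1)); last by apply: contra i2 => /eqP h; apply/eqP/val_inj.
    by rewrite ltn_eqF ?mul0r// kE.
  by rewrite kE in chr *; apply/eqP; rewrite -addr_eq0 mulr1n chr.
rewrite [X in _ *+ X](_ : _ = 0%N)// mulr0n oppr0.
have kM3 : (k.+2 < M.+1)%N by rewrite ltnS ltn_neqAle kM' .
rewrite (bigD1 (Ordinal kM3))/=; last first.
  by apply/andP; split; apply/eqP => -[] /eqP; rewrite gtn_eqF.
have e1 : (k.+2 == k :> nat) = false by rewrite gtn_eqF// ltnW.
have e2 : (k.+2 == k.+1 :> nat) = false by rewrite gtn_eqF.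
rewrite !mxE/= e1 e2 eqxx big1 ?addr0 ?addrA//.
move=> i /andP[/andP[i1 i2] i3]; rewrite !mxE.
rewrite (negbTE (_ : (i : nat) != k)); last by apply: contra i1 => /eqP h; apply/eqP/val_inj.
rewrite (negbTE (_ : (i : nat) != k.+1)); last by apply: contra i2 => /eqP h; apply/eqP/val_inj.
by rewrite (negbTE (_ : (i : nat) != k.+2)) ?mul0r.
Qed.

Definition uvec M : 'cV[R]_M.+1 := let Q n x := (P false z n).[x] in
  \col_(i < M.+1) (Q i 1 * Q M.+1 (-1) - Q i (-1) * Q M.+1 1).

Lemma Jmix_uvec M : Jmix P z M *m uvec M = 0.
Proof.
have -> : uvec M = (P false z M.+1).[-1] *: (\col_(i < M.+1) (P false z i).[1])
   - (P false z M.+1).[1] *: (\col_(i < M.+1) (P false z i).[-1]).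
  by apply/colP => i; rewrite !mxE; ring.
apply/colP => k; rewrite mulmxBr -!scalemxAr !mxE.
have := @Jmix_horner M 1 k; have := @Jmix_horner M (-1) k; rewrite !mxE.
move=> -> ; last by rewrite sqrrN expr1n.
move=> ->; last by rewrite expr1n.
by case: (_ == _); rewrite ?mulr1n ?mulr0n; ring.
Qed.

Lemma uvec_neq0 M : uvec M != 0.
Proof.
apply/eqP => /colP/(_ 0); rewrite !mxE.
have P0 : P false z 0 = (cc P false z 0)%:P.
  by rewrite [LHS]size1_polyC ?(size_P hP z0)// (ccE hP z0).
rewrite /= P0 !hornerC -mulrBr => /eqP; rewrite mulf_eq0 (negbTE (cc_neq0 hP z0 _ _))/=.
rewrite subr_eq0 => /eqP h; have := norm_horner_P_lt hP z0 false M.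
by rewrite h ltxx.
Qed.

Lemma A1_y0 M : A1 P z M *m col_mx (uvec M) 0 = 0.
Proof. by rewrite /A1 mul_block_col !mul0mx mulmx0 Jmix_uvec !addr0 col_mx0. Qed.

End ZeroEigenvector.

(** * The distribution in comoving variables *)

Section LowOrderZeros.
Context {R : realType} (P : bool -> R -> nat -> {poly R}).
Hypothesis hP : is_poly_family P.
Variable z : R.
Hypothesis z0 : 0 < z.

Lemma horner_rootsR l n x :
  size (rootsR (P l z n)) = n /\
  (P l z n).[x] = cc P l z n * \prod_(y <- rootsR (P l z n)) (x - y).
Proof.
have [s [us _ sn PE]] := zeros_P hP z0 l n.
have h := rootsR_P hP z0 us PE.
split; first by rewrite (perm_size h).
by rewrite [in LHS]PE hornerZ horner_rootprod -(perm_big _ h).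
Qed.

Lemma P0_const l : P l z 0 = (cc P l z 0)%:P.
Proof. by rewrite [LHS]size1_polyC ?(size_P hP z0)// (ccE hP z0). Qed.

Lemma horner0_P1 l : (P l z 1).[0] = - cc P l z 1 * xx P l z 1 1.
Proof.
have [+ ->] := horner_rootsR l 1 0; rewrite /xx/=.
case: (rootsR _) => [|a [|b s]]//= _; rewrite big_seq1; ring.
Qed.

Lemma horner0_P2 l : (P l z 2).[0] = cc P l z 2 * xx P l z 1 2 * xx P l z 2 2.
Proof.
have [+ ->] := horner_rootsR l 2 0; rewrite /xx/=.
case: (rootsR _) => [|a [|b [|c s]]]//= _; rewrite big_cons big_seq1; ring.
Qed.

End LowOrderZeros.

Section Distribution.
Context {R : realType} (P : bool -> R -> nat -> {poly R}).
Hypothesis hP : is_poly_family P.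

(** The reproducing kernel at 0 of the polynomials of degree less than [n]. *)
Definition repro0 l (y : R) n : {poly R} := \sum_(i < n) (P l y i).[0] *: P l y i.

Definition slotpoly l (y : R) k : {poly R} :=
  if (slot k).1 == l then P l y (slot k).2 else 0.

(** The distribution is linear in all unknowns except the velocity and the
    temperature, and [colpoly] is the polynomial that multiplies the [j]-th one.
    The bulk pressure and the heat flux carry reproducing kernels at 0, so that
    their contributions to the low moments are values at 0. *)
Definition colpoly l (y : R) (j : nat) : {poly R} :=
  match j with
  | 0 => if l then 0 else 1
  | 1 | 2 => 0
  | 3 => if l then 0 else - repro0 false y 3
  | 4 => if l then - repro0 true y 2 else 0
  | _ => slotpoly l y j
  end.

Definition ncolpoly l (y : R) j : {poly R} := (mom y 1)^-1 *: colpoly l y j.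

Variable M : nat.
Hypothesis hM : (1 <= M)%N.
Local Notation state := 'cV[R]_(M.+1 + M).

Definition statepoly l (W : state) (y : R) : {poly R} :=
  \sum_(j < M.+1 + M) entry W j *: ncolpoly l y j.

Lemma entryE (W : state) (j : 'I_(M.+1 + M)) : entry W j = W j 0.
Proof. by rewrite /entry valK. Qed.

Lemma entry_out (W : state) k : (M.+1 + M <= k)%N -> entry W k = 0.
Proof. by move=> h; rewrite /entry insubF// ltnNge h. Qed.

(** Absent entries count as 0: the formula includes states of three components. *)
Lemma sum_first5 (f : nat -> R) (W : state) : (forall j, (5 <= j)%N -> f j = 0) ->
  \sum_(j < M.+1 + M) W j 0 * f j =
  entry W 0 * f 0%N + entry W 1 * f 1%N + entry W 2 * f 2%N + entry W 3 * f 3%N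
  + entry W 4 * f 4%N.
Proof.
move=> f5; under eq_bigr do rewrite -entryE.
rewrite -(big_mkord xpredT (fun j => entry W j * f j)).
transitivity (\sum_(0 <= j < (M.+1 + M) + 5) entry W j * f j).
  rewrite [RHS](@big_cat_nat _ _ _ (M.+1 + M))//= ?leq_addr//.
  rewrite [X in _ = _ + X]big_nat_cond [X in _ = _ + X]big1 ?addr0// => j /andP[/andP[h _] _].
  by rewrite entry_out// mul0r.
rewrite (@big_cat_nat _ _ _ 5)//= ?leq_addl//.
rewrite [X in _ + X]big_nat_cond [X in _ + X]big1 ?addr0; last first.
  by move=> j /andP[/andP[h _] _]; rewrite f5// mulr0.
by rewrite !big_nat_recr//= big_nil add0r.
Qed.

Lemma basisE u th k p : `|u| < 1 ->
  Defs.basis P u th k p = gg u th p *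
    ((slotpoly false th^-1 k).[EE u p] + QQ u p * (slotpoly true th^-1 k).[EE u p]).
Proof.
move=> u1; rewrite /Defs.basis /Ptilde /slotpoly pperpE//.
by case: (slot k) => [[] n] /=; rewrite horner0; ring.
Qed.

(** The zeros in the coefficients of the bulk pressure and of the heat flux are
    those of the polynomials of degree at most 2, whose products give the values
    at 0. *)
Lemma coeff_sum (W : state) (E q : R) : 0 < theta W ->
  \sum_(k < M.+1 + M) coeff P W k 0 *
     ((slotpoly false (zeta W) k).[E] + q * (slotpoly true (zeta W) k).[E]) =
  \sum_(k < M.+1 + M) entry W k *
     ((colpoly false (zeta W) k).[E] + q * (colpoly true (zeta W) k).[E]).
Proof.
move=> th0; have z0 : 0 < zeta W by rewrite invr_gt0.
set z := zeta W in z0 *.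
have c0 := cc_neq0 hP z0 false 0.
have s0 : slotpoly false z 0 = (cc P false z 0)%:P by rewrite /slotpoly/= (P0_const hP z0).
have [M1|M1] := boolP (M == 1%N).
  under eq_bigr do rewrite mxE M1/=.
  have S3 (f : nat -> R) : \sum_(0 <= k < M.+1 + M) f k = f 0%N + f 1%N + f 2%N.
    by rewrite (eqP M1) !big_nat_recr//= big_nil add0r.
  rewrite -[LHS](big_mkord xpredT (fun k => coeff1 P W k * ((slotpoly false z k).[E] + q * (slotpoly true z k).[E]))).
  rewrite -[RHS](big_mkord xpredT (fun k => entry W k * ((colpoly false z k).[E] + q * (colpoly true z k).[E]))).
  rewrite !S3 s0 /slotpoly/= !hornerE /coeff1/= /rho -/z.
  by field.
have M2 : (2 <= M)%N by rewrite ltn_neqAle eq_sym M1.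
under eq_bigr do rewrite mxE (negbTE M1).
rewrite -[LHS](big_mkord xpredT (fun k => coeff2 P W k * ((slotpoly false z k).[E] + q * (slotpoly true z k).[E]))).
rewrite -[RHS](big_mkord xpredT (fun k => entry W k * ((colpoly false z k).[E] + q * (colpoly true z k).[E]))).
have N5 : (5 <= M.+1 + M)%N by lia.
rewrite (@big_cat_nat _ _ _ 5)//= [RHS](@big_cat_nat _ _ _ 5)//=; congr (_ + _); last first.
  rewrite big_nat_cond [RHS]big_nat_cond; apply: eq_bigr => k /andP[/andP[k5 _] _].
  by case: k k5 => [|[|[|[|[|k]]]]].
rewrite !big_nat_recr//= !big_nil !add0r.
rewrite s0 /slotpoly/= /repro0 !big_ord_recr !big_ord0/= !add0r.
rewrite !(P0_const hP z0) !hornerE (horner0_P1 hP z0) (horner0_P2 hP z0) (horner0_P1 hP z0).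
rewrite -/z -/(bulk W) -/(heat W) -/(rho W)/=.
by field.
Qed.

Lemma FF_statepoly (W : state) p : 0 < theta W -> `|vel W| < 1 ->
  FF P W p = 2^-1 * expR (- zeta W * EE (vel W) p) *
    ((statepoly false W (zeta W)).[EE (vel W) p]
     + QQ (vel W) p * (statepoly true W (zeta W)).[EE (vel W) p]).
Proof.
move=> th0 u1; rewrite /FF.
under eq_bigr do rewrite basisE// -/(zeta W) -mulrA [_ * coeff _ _ _ _]mulrC.
rewrite -mulr_sumr coeff_sum// /gg -/(zeta W) besselK1_mom.
rewrite /statepoly !horner_sum [X in _ = _ * (_ + X)]mulr_sumr -big_split/= invfM.
rewrite -[RHS]mulrA -[LHS]mulrA -!mulrA; congr (_ * _).
rewrite mulrCA; congr (_ * _); rewrite mulr_sumr; apply: eq_bigr => j _.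
by rewrite !hornerZ; ring.
Qed.

End Distribution.

(** * Derivatives of the distribution *)

Section DerivativesOfDistribution.
Context {R : realType} (P : bool -> R -> nat -> {poly R}).
Hypothesis hP : is_poly_family P.
Variable M : nat.
Hypothesis hM : (1 <= M)%N.
Local Notation state := 'cV[R]_(M.+1 + M).

Lemma derive_line (f : state -> R) (W v : state) (g : R -> R) (d : R) :
  (\forall h \near (0 : R), g h = f (h *: v + W)) ->
  is_derive (0 : R) 1 g d -> 'D_v (f : state -> R^o) W = d.
Proof.
move=> gf dg.
have : is_derive (0 : R) 1 (fun h => f (h *: v + W)) d by exact: near_eq_is_derive gf dg.
move=> [_ <-]; rewrite /derive.
have <- : (fun h : R => h^-1 *: (((fun k : R => f (k *: v + W)) \o shift (0 : R)) (h *: (1 : R)) - f ((0 : R) *: v + W)))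
  = (fun h : R => h^-1 *: ((f \o shift W) (h *: v) - f W)).
  by apply/funext => h /=; rewrite [_ *: 1]mulr1 addr0 scale0r add0r.
by [].
Qed.

Lemma entry_line (W : state) (h : R) (j : 'I_(M.+1 + M)) k :
  entry (h *: delta_mx j 0 + W) k = entry W k + h * (k == j)%:R.
Proof.
rewrite /entry; case: insubP => [i _ <-|]; first by rewrite !mxE eqxx andbT addrC.
move=> kN; rewrite (_ : (k == j) = false) ?mulr0 ?addr0//.
by apply: contraNF kN => /eqP->; exact: ltn_ord.
Qed.

Lemma statepoly_line l (W : state) (h : R) (j : 'I_(M.+1 + M)) y :
  statepoly P l (h *: delta_mx j 0 + W) y = statepoly P l W y + h *: ncolpoly P l y j.
Proof.
rewrite /statepoly.
under eq_bigr do rewrite entry_line scalerDl.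
rewrite big_split/=; congr (_ + _).
rewrite (bigD1 j)//= eqxx mulr1 big1 ?addr0// => i ij.
by rewrite (negbTE (_ : (i : nat) != j)) ?mulr0 ?scale0r.
Qed.

Variable W : state.
Hypotheses (th0 : 0 < theta W) (u1 : `|vel W| < 1).
Local Notation z := (zeta W).
Local Notation u := (vel W).

Let z0 : 0 < z. Proof. by rewrite invr_gt0. Qed.

(** [ev a b] is the weighted function with even part [a] and odd part [b] in
    the comoving momentum. *)
Definition ev (a b : {poly R}) p : R :=
  2^-1 * expR (- z * EE u p) * (a.[EE u p] + QQ u p * b.[EE u p]).

Lemma derive_FF_linear (j : 'I_(M.+1 + M)) p : (j : nat) != 1%N -> (j : nat) != 2%N ->
  'D_(delta_mx j 0) (fun W' : state => (FF P W' p : R^o)) W =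
  ev (ncolpoly P false z j) (ncolpoly P true z j) p.
Proof.
move=> j1 j2.
apply: (@derive_line _ _ _ (fun h => FF P W p + h * ev (ncolpoly P false z j) (ncolpoly P true z j) p)).
- near=> h.
  have velE : vel (h *: delta_mx j 0 + W) = u.
    by rewrite /vel entry_line eq_sym (negbTE j1) mulr0 addr0.
  have thE : theta (h *: delta_mx j 0 + W) = theta W.
    by rewrite /theta entry_line eq_sym (negbTE j2) mulr0 addr0.
  have zE : zeta (h *: delta_mx j 0 + W) = z by rewrite /zeta thE.
  rewrite !(FF_statepoly hP hM) ?velE ?thE// zE !statepoly_line /ev !hornerD !hornerZ.
  ring.
- by apply: is_derive_eq; rewrite /GRing.scale/=; ring.
Unshelve. all: by end_near. Qed.

Lemma is_derive_U0 : is_derive u 1 (@U0 R) (u * U0 u ^+ 3).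
Proof.
have u2 : 0 < 1 - u ^+ 2 by rewrite subr_gt0 -real_normK ?num_real// expr_lt1.
have dc : is_derive u 1 (fun x : R => 1 - x ^+ 2) (- (2 * u)).
  by apply: is_derive_eq; rewrite /GRing.scale/=; ring.
have ds := @is_derive1_comp R (@Num.sqrt R) (fun x : R => 1 - x ^+ 2) u _ _ (is_derive1_sqrt u2) dc.
have s0 : Num.sqrt (1 - u ^+ 2) != 0 by rewrite gt_eqF// sqrtr_gt0.
have dV := @is_deriveV _ (fun x : R => Num.sqrt (1 - x ^+ 2)) u _ 1 s0 ds.
suff -> : u * U0 u ^+ 3 = - Num.sqrt (1 - u ^+ 2) ^- 2 *:
   ((2 * Num.sqrt (1 - u ^+ 2))^-1 * - (2 * u)) by exact: dV.
by rewrite /U0 /GRing.scale/=; field; exact: s0.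
Qed.

Lemma is_derive_EE p : is_derive u 1 (fun x => EE x p) (U0 u ^+ 2 * QQ u p).
Proof.
have h0 := is_derive_U0; have h := U0_U1 u1.
rewrite /EE /U1; apply: is_derive_eq; rewrite /GRing.scale/= /QQ.
have E : U0 u = U0 u * (U0 u ^+ 2 - U1 u ^+ 2) by rewrite h mulr1.
apply: (@eq_trans _ _ (u * U0 u ^+ 3 * p0 p - (U0 u * (U0 u ^+ 2 - U1 u ^+ 2) + u * (u * U0 u ^+ 3)) * p)).
  by rewrite -E; ring.
by rewrite /U1; ring.
Qed.

Lemma is_derive_QQ p : is_derive u 1 (fun x => QQ x p) (U0 u ^+ 2 * EE u p).
Proof.
have h0 := is_derive_U0; have h := U0_U1 u1.
rewrite /QQ /U1; apply: is_derive_eq; rewrite /GRing.scale/= /EE.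
have E : U0 u = U0 u * (U0 u ^+ 2 - U1 u ^+ 2) by rewrite h mulr1.
apply: (@eq_trans _ _ ((U0 u * (U0 u ^+ 2 - U1 u ^+ 2) + u * (u * U0 u ^+ 3)) * p0 p - u * U0 u ^+ 3 * p)).
  by rewrite -E; ring.
by rewrite /U1; ring.
Qed.

Lemma is_derive_poly_comp (r : {poly R}) (f : R -> R) (x d : R) : is_derive x 1 f d ->
  is_derive x 1 (fun y => r.[f y]) (r^`().[f x] * d).
Proof.
by move=> df; apply: (@is_derive1_comp R (horner r) f x).
Qed.

Lemma is_derive_expR_comp (f : R -> R) (x d : R) : is_derive x 1 f d ->
  is_derive x 1 (fun y => expR (f y)) (expR (f x) * d).
Proof. by move=> df; apply: (@is_derive1_comp R expR f x). Qed.

Lemma is_derive_shift (f : R -> R) (x d : R) : is_derive x 1 f d ->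
  is_derive (0 : R) 1 (fun h => f (x + h)) d.
Proof.
move=> df.
have ds : is_derive (0 : R) 1 (fun h : R => x + h) 1.
  have ds : is_derive (0 : R) 1 (cst x + id : R -> R) (0 + 1) by exact: is_deriveD.
  by rewrite add0r in ds.
rewrite -[d]mulr1; apply: (@is_derive1_comp R f (fun h => x + h) 0) => //.
by rewrite addr0.
Qed.

(** A boost acts on functions of the comoving momentum as the derivation with
    [EE' = QQ] and [QQ' = EE], up to the factor [U0 u ^ 2]. *)
Lemma derive_FF_vel (j : 'I_(M.+1 + M)) p : (j : nat) = 1%N ->
  let A := statepoly P false W z in let B := statepoly P true W z in
  'D_(delta_mx j 0) (fun W' : state => (FF P W' p : R^o)) W =
  ev (U0 u ^+ 2 *: (('X^2 - 1) * (B^`() - z *: B) + 'X * B))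
     (U0 u ^+ 2 *: (A^`() - z *: A)) p.
Proof.
move=> j1 A B.
pose f x := 2^-1 * expR (- z * EE x p) * (A.[EE x p] + QQ x p * B.[EE x p]).
apply: (@derive_line _ _ _ (fun h => f (u + h))).
- near=> h.
  have velE : vel (h *: delta_mx j 0 + W) = u + h.
    by rewrite /vel entry_line j1 eqxx mulr1.
  have thE : theta (h *: delta_mx j 0 + W) = theta W.
    by rewrite /theta entry_line j1 mulr0 addr0.
  have zE : zeta (h *: delta_mx j 0 + W) = z by rewrite /zeta thE.
  have uh1 : `|u + h| < 1.
    near: h.
    have : (fun h => `|u + h|) @ (0 : R) --> `|u + 0|.
      by apply: cvg_norm; apply: cvgD; [exact: cvg_cst|exact: cvg_id].
    by rewrite addr0 => /cvgr_lt; apply.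
  rewrite (FF_statepoly hP hM) ?velE ?thE// zE !statepoly_line /ncolpoly/= j1/= !scaler0 !addr0.
  by [].
- apply: is_derive_shift; rewrite /f.
  have hE := is_derive_EE p; have hQ := is_derive_QQ p.
  have hA := is_derive_poly_comp A hE; have hB := is_derive_poly_comp B hE.
  have hz : is_derive u 1 (fun x => - z * EE x p) (- z * (U0 u ^+ 2 * QQ u p)).
    by apply: is_derive_eq; rewrite /GRing.scale/=; ring.
  have he := is_derive_expR_comp hz.
  apply: is_derive_eq; rewrite /GRing.scale/= /ev.
  rewrite !(hornerZ, hornerD, hornerM, hornerN, hornerXn, hornerX, hornerC).
  by rewrite -expr2 (EE_QQ u1); ring.
Unshelve. all: by end_near. Qed.

Lemma derive_FF_theta (j : 'I_(M.+1 + M)) p (Ad Bd : {poly R}) : (j : nat) = 2%N ->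
  pder (statepoly P false W) z Ad -> pder (statepoly P true W) z Bd ->
  'D_(delta_mx j 0) (fun W' : state => (FF P W' p : R^o)) W =
  ev (- z ^+ 2 *: (Ad - 'X * statepoly P false W z))
     (- z ^+ 2 *: (Bd - 'X * statepoly P true W z)) p.
Proof.
move=> j2 dA dB.
pose f y := 2^-1 * expR (- y * EE u p) *
  ((statepoly P false W y).[EE u p] + QQ u p * (statepoly P true W y).[EE u p]).
apply: (@derive_line _ _ _ (fun h => f (theta W + h)^-1)).
- near=> h.
  have velE : vel (h *: delta_mx j 0 + W) = u.
    by rewrite /vel entry_line j2 mulr0 addr0.
  have thE : theta (h *: delta_mx j 0 + W) = theta W + h.
    by rewrite /theta entry_line j2 eqxx mulr1.
  have zE : zeta (h *: delta_mx j 0 + W) = (theta W + h)^-1 by rewrite /zeta thE.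
  have th1 : 0 < theta W + h.
    near: h.
    have : (fun h => theta W + h) @ (0 : R) --> theta W + 0.
      by apply: cvgD; [exact: cvg_cst|exact: cvg_id].
    by rewrite addr0 => /cvgr_gt; apply.
  rewrite (FF_statepoly hP hM) ?velE ?thE// zE !statepoly_line /ncolpoly/= j2/= !scaler0 !addr0.
  by [].
- have df : is_derive z 1 f (ev (Ad - 'X * statepoly P false W z) (Bd - 'X * statepoly P true W z) p).
    have hA := is_derive_horner_path (EE u p) z0 dA.
    have hB := is_derive_horner_path (EE u p) z0 dB.
    have hz : is_derive z 1 (fun y => - y * EE u p) (- EE u p).
      by apply: is_derive_eq; rewrite /GRing.scale/=; ring.
    have he := is_derive_expR_comp hz.
    rewrite /f; apply: is_derive_eq; rewrite /GRing.scale/= /ev !hornerE/=; ring.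
  apply: (@is_derive_shift (fun t => f t^-1)).
  have hi : is_derive (theta W) 1 (fun t : R => t^-1) (- z ^+ 2).
    have hi := @is_deriveV _ (id : R -> R) (theta W) 1 1 (lt0r_neq0 th0) (is_derive_id _ _).
    suff -> : - z ^+ 2 = - (theta W) ^- 2 *: (1 : R) by exact: hi.
    by rewrite /zeta exprVn [RHS]mulr1.
  have := @is_derive1_comp R f (fun t => t^-1) (theta W) _ _ df hi.
  suff -> : ev (- z ^+ 2 *: (Ad - 'X * statepoly P false W z))
     (- z ^+ 2 *: (Bd - 'X * statepoly P true W z)) p = ev (Ad - 'X * statepoly P false W z) (Bd - 'X * statepoly P true W z) p * - z ^+ 2 by [].
  by rewrite /ev !hornerZ; ring.
Unshelve. all: by end_near. Qed.

End DerivativesOfDistribution.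

(** * The projected derivatives *)

Section ColumnsOfProjection.
Context {R : realType} (P : bool -> R -> nat -> {poly R}).
Hypothesis hP : is_poly_family P.

Lemma eform_scaled l y (c b : {poly R}) :
  eform y (wgt l * (((mom y 1)^-1 *: c) * b)) = wform l y (c * b).
Proof. by rewrite /wform -scalerAl -scalerAr eformZ. Qed.

(** By orthogonality and the reproducing property, the moments of the
    distribution of degree at most 2 involve only the first five unknowns. *)
Lemma ncolpoly_test l y j (b : {poly R}) : 0 < y -> (size b <= if l then 2 else 3)%N ->
  eform y (wgt l * (ncolpoly P l y j * b)) =
  match j with
  | 0 => if l then 0 else (mom y 1)^-1 * eform y b
  | 3 => if l then 0 else - b.[0]
  | 4 => if l then - b.[0] else 0
  | _ => 0
  end.
Proof.
move=> y0 sb; rewrite /ncolpoly eform_scaled.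
have W0 l' : wform l' y (0 * b) = 0 by rewrite mul0r -(scale0r (0 : {poly R})) wformZ mul0r.
have WN l' (r : {poly R}) : wform l' y (- r) = - wform l' y r by rewrite -scaleN1r wformZ mulN1r.
have far k : (5 <= k)%N -> wform l y (slotpoly P l y k * b) = 0.
  move=> k5; rewrite /slotpoly; case: eqP => [h|]; last by rewrite W0.
  rewrite mulrC (ortho_low (wformD l y) (wformZ l y) (size_P hP y0 l) (ortho_P hP y0 l))//.
  by apply: leq_trans sb _; have := slot_ge5 k5; rewrite h.
case: j => [|[|[|[|[|j]]]]]; rewrite /colpoly ?W0//; last exact: far.
- by case: l sb {far} => sb; rewrite ?W0// /wform /wgt !mul1r.
- case: l sb {far} => sb; rewrite ?W0// mulNr WN.
  by rewrite (repro (wformD false y) (wformZ false y) (size_P hP y0 false) (ortho_P hP y0 false)).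
- case: l sb {far} => sb; rewrite ?W0// mulNr WN.
  by rewrite (repro (wformD true y) (wformZ true y) (size_P hP y0 true) (ortho_P hP y0 true)).
Qed.

Lemma pdiff_ncolpoly l z j : 0 < z -> pdiff (fun y => ncolpoly P l y j) z.
Proof.
move=> z0; have dP l' n : pdiff (fun y => P l' y n) z by exact: pdiff_P.
have drep l' n : pdiff (fun y => - repro0 P l' y n) z.
  rewrite /repro0; under eq_fun do rewrite -scaleN1r.
  apply: pdiffZ; first exact: derivable_cst.
  apply: (@pdiff_sum _ n (fun i y => (P l' y i).[0] *: P l' y i)) => i _.
  apply: pdiffZ => //; have [Pd hPd] := pdiff_pder z0 (dP l' i).
  by have [] := is_derive_horner_path 0 z0 hPd.
rewrite /ncolpoly; apply: pdiffZ.
  apply: derivableV; first by rewrite gt_eqF// mom_gt0.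
  by have [] := is_derive_mom 1 z0.
case: j => [|[|[|[|[|j]]]]]; rewrite /colpoly; try exact: pdiff_cst.
- by case: l; [exact: pdiff_cst|exact: drep].
- by case: l; [exact: drep|exact: pdiff_cst].
- by rewrite /slotpoly; case: eqP => _; [exact: dP|exact: pdiff_cst].
Qed.

Variable M : nat.
Hypothesis hM : (1 <= M)%N.
Local Notation state := 'cV[R]_(M.+1 + M).

Lemma pder_statepoly l (W : state) z : 0 < z -> exists Pd : {poly R}, pder (statepoly P l W) z Pd.
Proof.
move=> z0; apply: pdiff_pder => //.
apply: (@pdiff_sum _ _ (fun j y => entry W j *: ncolpoly P l y j)) => j _.
by apply: pdiffZ; [exact: derivable_cst|exact: pdiff_ncolpoly].
Qed.

Lemma statepoly_test l (W : state) y (b : {poly R}) : 0 < y ->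
  (size b <= if l then 2 else 3)%N ->
  eform y (wgt l * (statepoly P l W y * b)) =
  if l then - (heat W * b.[0]) else rho W * ((mom y 1)^-1 * eform y b) - bulk W * b.[0].
Proof.
move=> y0 sb; rewrite /statepoly mulr_suml mulr_sumr eform_sum.
under eq_bigr do rewrite -scalerAl -scalerAr eformZ (ncolpoly_test _ y0 sb) entryE.
rewrite (@sum_first5 R M (fun j => match j with
  | 0 => if l then 0 else (mom y 1)^-1 * eform y b
  | 3 => if l then 0 else - b.[0]
  | 4 => if l then - b.[0] else 0
  | _ => 0
  end)); last by case=> [|[|[|[|[|j]]]]].
by rewrite /heat /rho /bulk; case: l {sb}; ring.
Qed.

Variable W : state.
Hypotheses (th0 : 0 < theta W) (u1 : `|vel W| < 1).
Local Notation z := (zeta W).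
Local Notation u := (vel W).
Variable Pd : bool -> {poly R}.
Hypothesis hPd : forall l, pder (statepoly P l W) z (Pd l).

Let z0 : 0 < z. Proof. by rewrite invr_gt0. Qed.

(** Even and odd parts of the derivative with respect to the [j]-th unknown. *)
Definition dcol l (j : nat) : {poly R} :=
  match j with
  | 1 => U0 u ^+ 2 *:
      (if l then (statepoly P false W z)^`() - z *: statepoly P false W z
       else ('X^2 - 1) * ((statepoly P true W z)^`() - z *: statepoly P true W z)
            + 'X * statepoly P true W z)
  | 2 => - z ^+ 2 *: (Pd l - 'X * statepoly P l W z)
  | _ => ncolpoly P l z j
  end.

Lemma derive_FF (j : 'I_(M.+1 + M)) p :
  'D_(delta_mx j 0) (fun W' : state => (FF P W' p : R^o)) W
  = ev W (dcol false j) (dcol true j) p.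
Proof.
have [j1|j1] := eqVneq (j : nat) 1%N.
  by rewrite (derive_FF_vel hP hM th0 u1 p j1) j1.
have [j2|j2] := eqVneq (j : nat) 2%N.
  by rewrite (derive_FF_theta hP hM th0 u1 p j2 (hPd false) (hPd true)) j2.
rewrite (derive_FF_linear hP hM th0 u1 p j1 j2).
by move: j1 j2; case: j => [[|[|[|j]]]].
Qed.

(** The factors [gg] cancel, and what remains is an integral over comoving
    momenta of a polynomial in [EE] and [QQ], in which [QQ ^ 2] is [EE ^ 2 - 1]. *)
Lemma DD_eform (k j : 'I_(M.+1 + M)) : DD P W k j =
  eform z (dcol false j * slotpoly P false z k + ('X^2 - 1) * (dcol true j * slotpoly P true z k)).
Proof.
rewrite mxE /innerp.
set r := _ + _.
pose s := dcol false j * slotpoly P true z k + dcol true j * slotpoly P false z k.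
have E := integral_horner_EE (2^-1 *: r) (2^-1 *: s) u1 z0.
rewrite (_ : eform z r = 2 * eform z (2^-1 *: r)); last first.
  by rewrite eformZ mulrA divff// mul1r.
rewrite -E; apply: eq_Rintegral => p _.
rewrite derive_FF (basisE P) // /ev.
have g0 : gg u (theta W) p != 0.
  by rewrite /gg besselK1_mom mulf_neq0 ?gt_eqF ?expR_gt0// invr_gt0 mulr_gt0// mom_gt0.
rewrite -/z (mulrCA _ (gg _ _ _)) [X in X / p0 p]mulrAC divff// mul1r.
rewrite /r /s !(hornerZ, hornerD, hornerM, hornerN, hornerXn, hornerX, hornerC).
by rewrite -?expr2 (EE_QQ u1); ring.
Qed.

Definition tested l (v : state) m :=
  forall k : 'I_(M.+1 + M), (slot k).1 = l -> ((slot k).2 < m)%N -> (DD P W *m v) k 0 = 0.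

(** The [P l z n] with [n < m] span the polynomials of degree less than [m]. *)
Lemma tested_poly l (v : state) m (b : {poly R}) :
  (forall n, (n < m)%N -> (unslot (l, n) < M.+1 + M)%N) ->
  tested l v m -> (size b <= m)%N ->
  \sum_(j < M.+1 + M) v j 0 * eform z (wgt l * (dcol l j * b)) = 0.
Proof.
move=> mN tv sb.
pose c := \sum_(j < M.+1 + M) v j 0 *: dcol l j.
have cE (r : {poly R}) : \sum_(j < M.+1 + M) v j 0 * eform z (wgt l * (dcol l j * r)) = eform z (wgt l * (c * r)).
  rewrite /c mulr_suml mulr_sumr eform_sum; apply: eq_bigr => j _.
  by rewrite -scalerAl -scalerAr eformZ.
rewrite cE (ortho_expand (wformD l z) (wformZ l z) (size_P hP z0 l) (ortho_P hP z0 l) sb).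
rewrite !mulr_sumr eform_sum big1// => i _.
rewrite -!scalerAr eformZ -cE.
have := tv (Ordinal (mN i (ltn_ord i))); rewrite /= unslotK/= => /(_ erefl (ltn_ord i)).
rewrite mxE => H; rewrite [X in _ * X](_ : _ = 0) ?mulr0// -[RHS]H.
apply: eq_bigr => j _; rewrite DD_eform /slotpoly/= unslotK/= mulrC; congr (_ * _); congr (eform z _).
by case: l {tv mN sb c cE H}; rewrite /wgt/= !mulr0 ?mul1r ?addr0 ?add0r.
Qed.

(** [statepoly_test] holds for every inverse temperature, hence may be
    differentiated; the factor [- z ^+ 2] is the derivative of [z] in the
    temperature. *)
Lemma dcol2_test l (b : {poly R}) : (size b <= if l then 2 else 3)%N ->
  eform z (wgt l * (dcol l 2 * b)) =
  if l then 0 else - z ^+ 2 * (rho W * 'D_1 (fun y => (mom y 1)^-1 * eform y b) z).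
Proof.
move=> sb.
have h1 := is_derive_eform z0 (pder_cstM (wgt l * b) (hPd l)).
have fE y : 0 < y -> eform y (statepoly P l W y * (wgt l * b)) =
    if l then - (heat W * b.[0]) else rho W * ((mom y 1)^-1 * eform y b) - bulk W * b.[0].
  by move=> y0; rewrite -statepoly_test// mulrCA.
have h2 := is_derive_eq_pos z0 fE h1.
have -> : wgt l * (dcol l 2 * b) = - z ^+ 2 *: (Pd l * (wgt l * b) - 'X * (statepoly P l W z * (wgt l * b))).
  by rewrite /dcol -!mul_polyC; ring.
rewrite eformZ.
case: l {fE h1 sb} h2 => h2.
  rewrite (_ : eform z _ = 0) ?mulr0//.
  by have [_ <-] := h2; rewrite derive_cst.
pose f y := (mom y 1)^-1 * eform y b.
have df : derivable f z 1.
  have [d1 _] := is_derive_mom 1 z0.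
  have [Bd hBd] := pdiff_pder z0 (pdiff_cst b z).
  have [d2 _] := is_derive_eform z0 hBd.
  by apply: derivableM => //; apply: derivableV => //; rewrite gt_eqF// mom_gt0.
have hf : is_derive z 1 (fun y => rho W * f y - bulk W * b.[0]) (rho W * 'D_1 f z).
  have f' := @derivableP _ _ _ _ _ _ df.
  clear h2; apply: is_derive_eq; rewrite /GRing.scale/=; ring.
by congr (_ * _); have [_ <-] := h2; have [_ <-] := hf.
Qed.

End ColumnsOfProjection.

(** * Invertibility and the velocity component *)

Section MomentInequalities.
Context {R : realType}.

(** Strict Cauchy-Schwarz inequality for [sqrt (x ^ k)] and [x * sqrt (x ^ k)]. *)
Lemma mom_log_convex (z : R) k : 0 < z -> mom z k.+1 ^+ 2 < mom z k * mom z k.+2.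
Proof.
move=> z0; pose c := mom z k.+1 / mom z k.
have mk := mom_gt0 k z0.
have : 0 < eform z ('X^k * ('X - c%:P) ^+ 2).
  apply: eform_gt0 => //.
    by rewrite mulf_neq0 ?expf_neq0 ?polyXsubC_eq0 ?polyX_eq0.
  move=> x x1; rewrite hornerM !horner_exp hornerX mulr_ge0 ?sqr_ge0//.
  by rewrite exprn_ge0// (le_trans ler01).
have -> : 'X^k * ('X - c%:P) ^+ 2 = 'X^(k.+2) - (2 * c) *: 'X^(k.+1) + c ^+ 2 *: 'X^k :> {poly R}.
  by rewrite -!mul_polyC !exprS !polyCM ?expr0 ?polyC_natr; ring.
rewrite eformD eformB !eformZ !eformXn => h.
have E : mom z k * (mom z k.+2 - 2 * c * mom z k.+1 + c ^+ 2 * mom z k) =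
  mom z k * mom z k.+2 - mom z k.+1 ^+ 2.
  by rewrite /c; field; rewrite gt_eqF.
by rewrite -subr_gt0 -E mulr_gt0.
Qed.

Lemma derive_mean (z : R) n : 0 < z ->
  'D_1 (fun y => (mom y 1)^-1 * eform y 'X^n) z =
  (mom z 2 * mom z n - mom z 1 * mom z n.+1) / mom z 1 ^+ 2.
Proof.
move=> z0; have m1 : mom z 1 != 0 by rewrite gt_eqF// mom_gt0.
have d1 := is_derive_mom 1 z0; have d2 := is_derive_mom n z0.
have -> : (fun y : R => (mom y 1)^-1 * eform y 'X^n) = (fun y => (mom y 1)^-1 * mom y n).
  by apply/funext => y; rewrite eformXn.
have dV := @is_deriveV _ (fun y => mom y 1) z _ 1 m1 d1.
apply: derive_val; apply: is_derive_eq.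
by rewrite /GRing.scale/=; field.
Qed.

End MomentInequalities.

Lemma unitmx_inj (F : fieldType) n (B : 'M[F]_n) : (forall v : 'cV_n, B *m v = 0 -> v = 0) -> B \in unitmx.
Proof.
move=> Binj; rewrite -unitmx_tr -row_free_unit -kermx_eq0.
apply/eqP/row_matrixP => i; rewrite row0.
apply: trmx_inj; rewrite trmx0; apply: Binj.
by apply: trmx_inj; rewrite trmx_mul trmxK -row_mul mulmx_ker row0 trmx0.
Qed.

Section Invertibility.
Context {R : realType} (P : bool -> R -> nat -> {poly R}).
Hypothesis hP : is_poly_family P.
Variable M : nat.
Hypothesis hM : (1 <= M)%N.
Local Notation state := 'cV[R]_(M.+1 + M).
Variable W : state.
Hypothesis GW : admissible W.
Local Notation z := (zeta W).
Local Notation u := (vel W).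

Let rho0 : 0 < rho W. Proof. by case: GW. Qed.
Let u1 : `|u| < 1. Proof. by case: GW. Qed.
Let th0 : 0 < theta W. Proof. by case: GW. Qed.
Let z0 : 0 < z. Proof. by rewrite invr_gt0. Qed.
Let m1 : mom z 1 != 0. Proof. by rewrite gt_eqF// mom_gt0. Qed.

Variable Pd : bool -> {poly R}.
Hypothesis hPd : forall l, pder (statepoly P l W) z (Pd l).
Local Notation A := (statepoly P false W z).
Local Notation dcol := (dcol P W Pd).

Lemma dcol_test l j (b : {poly R}) : j != 1%N -> j != 2%N ->
  (size b <= if l then 2 else 3)%N ->
  eform z (wgt l * (dcol l j * b)) =
  match j with
  | 0 => if l then 0 else (mom z 1)^-1 * eform z b
  | 3 => if l then 0 else - b.[0]
  | 4 => if l then - b.[0] else 0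
  | _ => 0
  end.
Proof.
move=> j1 j2 sb; have := ncolpoly_test hP j z0 sb.
by case: j j1 j2 => [|[|[|j]]].
Qed.

Lemma test_sum l (v : state) m (b : {poly R}) :
  (forall n, (n < m)%N -> (unslot (l, n) < M.+1 + M)%N) ->
  tested P W l v m -> (size b <= m)%N -> (m <= if l then 2 else 3)%N ->
  entry v 1 * eform z (wgt l * (dcol l 1 * b)) +
  (if l then - (entry v 4 * b.[0])
   else entry v 0 * ((mom z 1)^-1 * eform z b)
        + entry v 2 * (- z ^+ 2 * (rho W * 'D_1 (fun y => (mom y 1)^-1 * eform y b) z))
        - entry v 3 * b.[0]) = 0.
Proof.
move=> mN tv sb mm; have sb' := leq_trans sb mm.
have far j : (5 <= j)%N -> eform z (wgt l * (dcol l j * b)) = 0.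
  move=> j5; rewrite dcol_test//; last 2 first.
  - by rewrite gtn_eqF// (leq_trans _ j5).
  - by rewrite gtn_eqF// (leq_trans _ j5).
  by case: j j5 => [|[|[|[|[|j]]]]].
have := tested_poly hP hM th0 u1 hPd mN tv sb.
rewrite (@sum_first5 R M (fun j => eform z (wgt l * (dcol l j * b))) v far).
rewrite (dcol2_test hP th0 hPd sb').
rewrite (@dcol_test l 0 b isT isT sb') (@dcol_test l 3 b isT isT sb') (@dcol_test l 4 b isT isT sb').
by case: l {far sb' mm mN tv} => /= H; rewrite -[RHS]H; ring.
Qed.

(** Integration by parts transfers the boost derivation to the test functions,
    which become [EE ^ 2 + QQ ^ 2] and [EE] up to sign. *)
Lemma dcol1_test :
  eform z (wgt true * (dcol true 1 * 'X)) = - (U0 u ^+ 2 * (rho W * ((mom z 1)^-1 * mom z 2 + theta W) + bulk W))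
  /\ eform z (wgt true * (dcol true 1 * 1)) = - (U0 u ^+ 2 * rho W).
Proof.
rewrite /dcol/=; split.
  have -> : ('X^2 - 1) * ((U0 u ^+ 2 *: (A^`() - z *: A)) * 'X)
    = U0 u ^+ 2 *: ((('X^2 - 1) * ((A * 'X)^`() - z *: (A * 'X)) + 'X * (A * 'X)) - A * (2%:R *: 'X^2 - 1)).
    by rewrite derivM derivX -!mul_polyC polyC_natr; ring.
  rewrite eformZ eformB eform_by_parts// sub0r mulrN; congr (- (_ * _)).
  have sb : (size (2%:R *: 'X^2 - 1 : {poly R})%R <= 3)%N.
    rewrite (leq_trans (size_polyD _ _))// size_polyN size_poly1 geq_max andbT.
    by rewrite (leq_trans (size_scale_leq _ _))// size_polyXn.
  have := statepoly_test hP (l := false) W z0 sb.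
  rewrite /wgt mul1r => ->; rewrite eformB eformZ -(expr0 'X) !eformXn.
  rewrite !(hornerZ, hornerD, hornerN, hornerXn) expr0n/= expr0.
  have H := mom_by_parts z0; have thE : theta W = z^-1 by rewrite /zeta invrK.
  have H2 : mom z 0 = mom z 2 - mom z 1 / z by rewrite [mom z 1]H; field; rewrite gt_eqF.
  by rewrite H2 thE; field; rewrite m1 gt_eqF.
have -> : ('X^2 - 1) * ((U0 u ^+ 2 *: (A^`() - z *: A)) * 1)
    = U0 u ^+ 2 *: ((('X^2 - 1) * (A^`() - z *: A) + 'X * A) - A * 'X).
  by rewrite -!mul_polyC; ring.
rewrite eformZ eformB eform_by_parts// sub0r mulrN; congr (- (_ * _)).
have sb : (size ('X : {poly R}) <= 3)%N by rewrite size_polyX.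
have := statepoly_test hP (l := false) W z0 sb.
by rewrite /wgt mul1r => ->; rewrite eformX hornerX mulr0 subr0 mulVf// mulr1.
Qed.

(** The test function [QQ * EE], or [QQ] if [M = 1], sees only the velocity. Its
    coefficient is nonzero because the bulk pressure exceeds [- rho * theta]. *)
Lemma vel_component0 (v : state) : tested P W true v 2 -> entry v 1 = 0.
Proof.
move=> tv; have [d1X d11] := dcol1_test.
have U0p : 0 < U0 u ^+ 2 by rewrite exprn_gt0// U0_gt0.
have [M1|M2] : M = 1%N \/ (2 <= M)%N by lia.
  have tv1 : tested P W true v 1 by move=> k sk k1; apply: tv => //; exact: ltnW.
  have mN n : (n < 1)%N -> (unslot (true, n) < M.+1 + M)%N by rewrite /unslot/=; lia.
  have := @test_sum true v 1 1 mN tv1; rewrite size_poly1 => /(_ isT isT).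
  rewrite d11 (@entry_out _ _ v 4); last by lia.
  rewrite mul0r oppr0 addr0 => /eqP.
  by rewrite mulrN oppr_eq0 mulf_eq0 (gt_eqF (mulr_gt0 U0p rho0)) orbF => /eqP.
have mN n : (n < 2)%N -> (unslot (true, n) < M.+1 + M)%N by rewrite /unslot/=; lia.
have := @test_sum true v 2 'X mN tv; rewrite size_polyX => /(_ isT isT).
rewrite d1X hornerX mulr0 oppr0 addr0 => /eqP.
have bk : - (rho W * theta W) < bulk W by case: GW => _ _ _; apply.
have pos : 0 < rho W * ((mom z 1)^-1 * mom z 2 + theta W) + bulk W.
  have : 0 < rho W * ((mom z 1)^-1 * mom z 2) by rewrite !mulr_gt0 ?invr_gt0 ?mom_gt0.
  by rewrite mulrDr; lra.
by rewrite mulrN oppr_eq0 mulf_eq0 (gt_eqF (mulr_gt0 U0p pos)) orbF => /eqP.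
Qed.

Lemma DD_far (k j : 'I_(M.+1 + M)) : (5 <= j)%N -> DD P W k j = (k == j)%:R.
Proof.
move=> j5; rewrite (DD_eform hP hM th0 u1 hPd).
have dE l : dcol l j = (mom z 1)^-1 *: slotpoly P l z j.
  by case: j j5 => [[|[|[|[|[|j]]]]] ?].
have -> : (k == j) = (slot k == slot j) by rewrite (can_eq slotK).
have t1 := eform_scaled true z (slotpoly P true z j) (slotpoly P true z k).
have t0 := eform_scaled false z (slotpoly P false z j) (slotpoly P false z k).
rewrite [wgt false]/= mul1r in t0.
rewrite eformD !dE t0 t1 /slotpoly.
have W0 l : wform l z 0 = 0 by rewrite -(scale0r (0 : {poly R})) wformZ mul0r.
case: (slot k) (slot j) => [[] n] [[] m] /=; rewrite ?mul0r ?mulr0 ?W0 ?addr0 ?add0r//.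
  by rewrite (ortho_P hP z0) eq_sym xpair_eqE.
by rewrite (ortho_P hP z0) eq_sym xpair_eqE.
Qed.

(** The test functions [QQ * EE], [EE], [EE ^ 2], 1 and [QQ] isolate in turn the
    velocity, density, temperature, bulk pressure and heat flux; if [M = 1],
    these are [QQ], [EE] and 1. The coefficient of the temperature is, up
    to a nonzero factor, the difference of the two sides of [mom_log_convex].
    The columns of the other unknowns are unit vectors by [DD_far]. *)
Lemma DD_inj (v : state) : DD P W *m v = 0 -> v = 0.
Proof.
move=> Dv; have tv l m : tested P W l v m by move=> k _ _; rewrite Dv mxE.
have v1 : entry v 1 = 0 by exact: vel_component0.
have zr : - z ^+ 2 * rho W != 0 by rewrite mulf_neq0 ?oppr_eq0 ?expf_neq0 ?gt_eqF.
have mX1 : (mom z 1)^-1 * eform z 'X = 1 by rewrite eformX mulVf.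
have D1 : 'D_1 (fun y : R => (mom y 1)^-1 * eform y 'X) z = 0.
  by have := derive_mean 1 z0; rewrite expr1 => ->; rewrite [mom z 2 * _]mulrC subrr mul0r.
have v0 : entry v 0 = 0.
  have mN n : (n < 2)%N -> (unslot (false, n) < M.+1 + M)%N by case: n => [|[]]//=; rewrite /unslot/=; lia.
  have := @test_sum false v 2 'X mN (tv _ _); rewrite size_polyX => /(_ isT isT).
  by rewrite v1 mX1 D1 hornerX !mulr0 mul0r add0r subr0 addr0 mulr1.
have v2 : entry v 2 = 0.
  have [M1|M2] : M = 1%N \/ (2 <= M)%N by lia.
    have mN n : (n < 1)%N -> (unslot (false, n) < M.+1 + M)%N by case: n => [|[]]//=.
    have := @test_sum false v 1 1 mN (tv _ _); rewrite size_poly1 => /(_ isT isT).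
    rewrite v1 v0 !mul0r !add0r (@entry_out _ _ v 3); last by lia.
    have := derive_mean 0 z0; rewrite expr0 => ->.
    rewrite mul0r subr0 [- _ ^+ 2 * _]mulrA => /eqP.
    have h : 0 < mom z 2 * mom z 0 - mom z 1 * mom z 1.
      by rewrite subr_gt0 -expr2 [ltRHS]mulrC; exact: mom_log_convex.
    have nz : - z ^+ 2 * rho W * ((mom z 2 * mom z 0 - mom z 1 * mom z 1) / mom z 1 ^+ 2) != 0.
      by rewrite mulf_neq0// mulf_neq0 ?(gt_eqF h)// invr_eq0 expf_neq0.
    by rewrite mulf_eq0 (negbTE nz) orbF => /eqP.
  have mN n : (n < 3)%N -> (unslot (false, n) < M.+1 + M)%N by case: n => [|[|[]]]//=; rewrite /unslot/=; lia.
  have := @test_sum false v 3 'X^2 mN (tv _ _); rewrite size_polyXn => /(_ isT isT).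
  rewrite v1 v0 !mul0r !add0r hornerXn expr0n/= mulr0 subr0 (derive_mean 2 z0).
  rewrite [- _ ^+ 2 * _]mulrA => /eqP.
  have h : mom z 2 * mom z 2 - mom z 1 * mom z 3 < 0.
    by rewrite subr_lt0 -expr2 mom_log_convex.
  have nz : - z ^+ 2 * rho W * ((mom z 2 * mom z 2 - mom z 1 * mom z 3) / mom z 1 ^+ 2) != 0.
    by rewrite mulf_neq0// mulf_neq0 ?(lt_eqF h)// invr_eq0 expf_neq0.
  by rewrite mulf_eq0 (negbTE nz) orbF => /eqP.
have v3 : entry v 3 = 0.
  have [M1|M2] : M = 1%N \/ (2 <= M)%N by lia.
    by apply: entry_out; lia.
  have mN n : (n < 1)%N -> (unslot (false, n) < M.+1 + M)%N by case: n => [|[]]//=.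
  have := @test_sum false v 1 1 mN (tv _ _); rewrite size_poly1 => /(_ isT isT).
  by rewrite v1 v0 v2 !mul0r !add0r hornerC mulr1 => /eqP; rewrite oppr_eq0 => /eqP.
have v4 : entry v 4 = 0.
  have [M1|M2] : M = 1%N \/ (2 <= M)%N by lia.
    by apply: entry_out; lia.
  have mN n : (n < 1)%N -> (unslot (true, n) < M.+1 + M)%N by rewrite /unslot/=; lia.
  have := @test_sum true v 1 1 mN (tv _ _); rewrite size_poly1 => /(_ isT isT).
  by rewrite v1 !mul0r !add0r hornerC mulr1 => /eqP; rewrite oppr_eq0 => /eqP.
have vlow (j : 'I_(M.+1 + M)) : (j < 5)%N -> v j 0 = 0.
  by rewrite -entryE; case: (j : nat) => [|[|[|[|[|]]]]].
apply/colP => k; rewrite [RHS]mxE; have [k5|k5] := ltnP k 5; first exact: vlow.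
have := congr1 (fun w : state => w k 0) Dv; rewrite !mxE => <-.
rewrite (bigD1 k)//= DD_far// eqxx mul1r big1 ?addr0// => j jk.
have [j5|j5] := ltnP j 5; first by rewrite vlow ?mulr0.
by rewrite DD_far// eq_sym (negbTE jk) mul0r.
Qed.

Lemma DD_unit : DD P W \in unitmx.
Proof. exact/unitmx_inj/DD_inj. Qed.

End Invertibility.

(** * The zeroth characteristic field *)

Section MainTheorem.
Context {R : realType} (P : bool -> R -> nat -> {poly R}).
Hypothesis hP : is_poly_family P.
Variable M : nat.
Hypothesis hM : (1 <= M)%N.
Local Notation state := 'cV[R]_(M.+1 + M).

Lemma lambda0E (W : state) : lambda0 W = vel W.
Proof. by rewrite /lambda0 /hatlambda0 subr0 mulr0 subr0 divr1. Qed.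

Lemma gradient_lambda0 (W : state) (j : 'I_(M.+1 + M)) :
  gradient (@lambda0 R M) W 0 j = (1%N == j :> nat)%:R.
Proof.
rewrite mxE; apply: (@derive_line _ _ _ _ _ (fun h => vel W + h * (1%N == j :> nat)%:R)).
  by near=> h; rewrite lambda0E /vel entry_line.
by apply: is_derive_eq; rewrite /GRing.scale/=; ring.
Unshelve. all: by end_near. Qed.

Lemma y0E (W : state) : y0 P W = col_mx (uvec P (zeta W) M) 0.
Proof. by []. Qed.

Lemma DD_r0 (W : state) : admissible W -> DD P W *m r0 P W = Pperm R M *m y0 P W.
Proof.
move=> GW; have z0 : 0 < zeta W by case: GW => _ _ th0 _; rewrite invr_gt0.
have [Ad hA] := pder_statepoly hP (M := M) false W z0.
have [Bd hB] := pder_statepoly hP (M := M) true W z0.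
have DU : DD P W \in unitmx.
  by apply: (@DD_unit _ _ hP _ hM _ GW (fun l => if l then Bd else Ad)); case.
by rewrite /r0 mulmxA mulmxV// mul1mx.
Qed.

Lemma characteristic_field0 :
  characteristic_field (@admissible R M) (@B0 R P M) (@B1 R P M)
    (@lambda0 R M) (@r0 R P M).
Proof.
move=> W GW; have DR := DD_r0 GW.
have z0 : 0 < zeta W by case: GW => _ _ th0 _; rewrite invr_gt0.
split.
  apply/eqP => r00; move: DR; rewrite r00 mulmx0 -(mulmx0 _ (Pperm R M)) => /Pperm_inj.
  rewrite y0E -col_mx0 => /eq_col_mx[/esym/eqP].
  by rewrite (negbTE (uvec_neq0 hP z0 M)).
have cancel (C : 'M[R]_(M.+1 + M)) :
    Pperm R M *m C *m (Pperm R M)^T *m DD P W *m r0 P W = Pperm R M *m (C *m y0 P W).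
  by rewrite -!mulmxA DR (mulmxA (Pperm R M)^T) Pperm_orthogonal mul1mx.
rewrite lambda0E [B0 P W *m _]cancel [B1 P W *m _]cancel.
rewrite !mulmxBl -!scalemxAl y0E (A1_y0 hP z0) !scaler0 !subr0.
by rewrite -!scalemxAr scalerA.
Qed.

(** The eigenvalue is the velocity, and [y0] has no odd component. *)
Lemma linearly_degenerate0 :
  linearly_degenerate (@admissible R M) (@lambda0 R M) (@r0 R P M).
Proof.
move=> W GW; have DR := DD_r0 GW.
have z0 : 0 < zeta W by case: GW => _ _ th0 _; rewrite invr_gt0.
have [Ad hA] := pder_statepoly hP (M := M) false W z0.
have [Bd hB] := pder_statepoly hP (M := M) true W z0.
have v1 : entry (r0 P W) 1 = 0.
  apply: (@vel_component0 _ _ hP _ hM _ GW (fun l => if l then Bd else Ad)); first by case.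
  by move=> k sk _; rewrite DR y0E Pperm_col_true.
apply: big1 => j _; rewrite gradient_lambda0.
by case: eqP => [h|_]; rewrite ?mul0r// -entryE -h v1 mulr0.
Qed.

End MainTheorem.

Theorem theorem5p3 (R : realType) (P : bool -> R -> nat -> {poly R})
    (hP : is_poly_family P) (M : nat) (hM : (1 <= M)%N) :
  characteristic_field (@admissible R M) (@B0 R P M) (@B1 R P M)
    (@lambda0 R M) (@r0 R P M)
  /\ linearly_degenerate (@admissible R M) (@lambda0 R M) (@r0 R P M).
Proof.
by split; [exact: characteristic_field0|exact: linearly_degenerate0].
Qed.
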